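(* Let $N\in\mathbb{N}$. Then $H_q\supseteq\Gamma_1(N)$ for almost all $q\in\mathbb{N}$ coprime to $N$ and for almost all primes $q\nmid N$, in the sense that, as $x\to\infty$, $$\#\{q\in\mathbb{N}:(q,N)=1,\ H_q\supseteq\Gamma_1(N),\ q\le x\}=\Big(\frac{\varphi(N)}{N}+o(1)\Big)x$$ and $$\#\{q\text{ prime}:q\nmid N,\ H_q\supseteq\Gamma_1(N),\ q\le x\}=(1+o(1))\pi(x).$$
   Context: For $q\in\mathbb{N}$ coprime to $N$, $H_q$ denotes the subgroup of $\Gamma_0(N)$ generated by all matrices $\begin{pmatrix}A&B\\C&D\end{pmatrix}\in\Gamma_0(N)$ with $A=q$. $\varphi$ is Euler's totient function and $\pi(x)$ the prime counting function. *)

(* Defs.v *)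
From HB Require Import structures.
From mathcomp Require Import all_boot all_order all_algebra.
From mathcomp Require Import boolp classical_sets reals topology normedtype sequences.
Set Implicit Arguments. Unset Strict Implicit. Unset Printing Implicit Defensive.
Import Order.TTheory GRing.Theory Num.Theory.
Local Open Scope ring_scope.

Definition entA (M : 'M[int]_2) : int := M 0 0.
Definition entC (M : 'M[int]_2) : int := M 1 0.
Definition entD (M : 'M[int]_2) : int := M 1 1.

Definition SL2Z (M : 'M[int]_2) : Prop := \det M = 1.

Definition Gamma0 (N : nat) (M : 'M[int]_2) : Prop :=
  SL2Z M /\ (N%:Z %| entC M)%Z.

Definition Gamma1 (N : nat) (M : 'M[int]_2) : Prop :=
  Gamma0 N M /\ (entA M = 1 %[mod N%:Z])%Z /\ (entD M = 1 %[mod N%:Z])%Z.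

Inductive gen_group (S : 'M[int]_2 -> Prop) : 'M[int]_2 -> Prop :=
| gen_base M : S M -> gen_group S M
| gen_one : gen_group S 1%:M
| gen_mul M1 M2 : gen_group S M1 -> gen_group S M2 -> gen_group S (M1 *m M2)
| gen_inv M : gen_group S M -> gen_group S (invmx M).

Definition Hq (N q : nat) : 'M[int]_2 -> Prop :=
  gen_group (fun M => Gamma0 N M /\ entA M = q%:Z).

Definition contains_Gamma1 (N q : nat) : Prop :=
  forall M, Gamma1 N M -> Hq N q M.

Definition count_upto (P : nat -> Prop) (x : nat) : nat :=
  \sum_(1 <= q < x.+1 | `[< P q >]) 1%N.

Definition primepi (x : nat) : nat := \sum_(0 <= p < x.+1 | prime p) 1%N.

(* Main.v *)
(** A matrix (a, b; N c, d) in Gamma_1(N) lies in H_q as soon as q + c factors as f g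
    with f = a + D c for some D inverse to q modulo N and g = q modulo N: with
    M = (q, *; N, D) the product M (a, b; N c, d) has first column (q f - c, N f), which
    a power of T turns into (q, N f), and T lies in H_q.  Replacing c by c + k a one may
    assume q + c = 1 modulo N, and then any divisor f of q + c in one prescribed
    invertible class modulo N c will do.

    For fixed c, almost all q (integers or primes) have such a divisor.  Call a class
    modulo M rich if the sum of 1/p over its primes diverges; the rich classes generate
    the whole unit group, by an elementary density argument, so the divisor can be taken
    to be a product of primes from prescribed rich classes.  That q + c has a prime factor
    in a set of primes with large reciprocal sum, for almost all q, is a large sieve
    bound, combined with Chebyshev's lower bound for pi(x) when q runs through primes.
    Finally Gamma_1(N) is finitely generated. *)
Require Import Defs.
From HB Require Import structures.
From mathcomp Require Import all_boot all_order all_algebra.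
From mathcomp Require Import boolp classical_sets reals topology normedtype sequences.
From mathcomp Require Import zify ring lra.
Import Order.TTheory GRing.Theory Num.Theory.
Import numFieldTopology.Exports numFieldNormedType.Exports.
Local Open Scope ring_scope.
Set Implicit Arguments. Unset Strict Implicit. Unset Printing Implicit Defensive.

(** * The large sieve *)

Lemma sum_periodic (V : zmodType) (u : nat -> V) (Q k : nat) :
  (forall n, u (n + Q)%N = u n) ->
  \sum_(n < (k * Q)%N) u n = (\sum_(n < Q) u n) *+ k.
Proof.
move=> uQ; elim: k => [|k IHk]; first by rewrite mul0n big_ord0.
rewrite mulSnr big_split_ord /= IHk mulrSr; congr (_ + _).
apply: eq_bigr => i _ /=; elim: k {IHk} => [|k IHk]; first by rewrite mul0n.
by rewrite mulSn -addnA addnC uQ.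
Qed.

Lemma periodic_modn (T : Type) (u : nat -> T) (Q n : nat) :
  (forall n, u (n + Q)%N = u n) -> u (n %% Q)%N = u n.
Proof.
move=> uQ; rewrite {2}(divn_eq n Q); elim: (n %/ Q)%N => [|k IHk].
  by rewrite mul0n.
by rewrite mulSn -addnA addnC uQ.
Qed.

(** Reduction modulo [m1] and [m2] is a bijection onto pairs of residues, which turns the sum over
    [m1 * m2] terms into a double sum. *)
Lemma sum_crt (R : comPzRingType) (u v : nat -> R) (m1 m2 : nat) :
  (0 < m1)%N -> (0 < m2)%N -> coprime m1 m2 ->
  (forall n, u (n + m1)%N = u n) -> (forall n, v (n + m2)%N = v n) ->
  \sum_(n < (m1 * m2)%N) u n * v n = (\sum_(n < m1) u n) * (\sum_(n < m2) v n).
Proof.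
move=> m1_gt0 m2_gt0 co um1 vm2.
rewrite big_distrlr /= pair_big /=.
pose h (n : 'I_(m1 * m2)) : 'I_m1 * 'I_m2 :=
  (Ordinal (ltn_pmod n m1_gt0), Ordinal (ltn_pmod n m2_gt0)).
have inj_h : injective h.
  move=> i j [/eqP e1 /eqP e2]; apply/val_inj => /=.
  have /eqP : i == j %[mod m1 * m2] by rewrite chinese_remainder // e1.
  by rewrite !modn_small.
rewrite (reindex h) /=; last first.
  apply: onW_bij; apply: inj_card_bij => //.
  by rewrite card_prod !card_ord.
by apply: eq_bigr => i _; rewrite (periodic_modn i um1) (periodic_modn i vm2).
Qed.

Lemma sum_prod_crt (R : comPzRingType) (u : nat -> nat -> R) (r : seq nat) :
  uniq r -> all prime r ->
  {in r, forall p n, u p (n + p)%N = u p n} ->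
  \sum_(n < \prod_(p <- r) p) \prod_(p <- r) u p n =
    \prod_(p <- r) \sum_(n < p) u p n.
Proof.
elim: r => [|p r IHr] /=; first by move=> *; rewrite !big_nil big_ord1 big_nil.
move=> /andP[pNr ur] /andP[pp pr] per; rewrite !big_cons.
have per_r q : q \in r -> forall n, u q (n + q)%N = u q n.
  by move=> qr; apply: per; rewrite inE qr orbT.
have per_p n : u p (n + p)%N = u p n by apply: per; rewrite mem_head.
have perW k n : (\prod_(q <- r) q %| k)%N -> \prod_(q <- r) u q (n + k)%N = \prod_(q <- r) u q n.
  move=> dv; apply: eq_big_seq => q qr.
  have /dvdnP[l ->] : (q %| k)%N.
    by apply: dvdn_trans dv; rewrite (big_rem q) //= dvdn_mulr.
  by elim: l => [|l IHl]; rewrite ?addn0 // mulSnr addnA per_r.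
rewrite -IHr // -(@sum_crt _ (u p) (fun n => \prod_(q <- r) u q n)) //.
- by apply: eq_bigr => i _; rewrite big_cons.
- exact: prime_gt0.
- rewrite big_seq; elim/big_ind: _ => // [|q /(allP pr)/prime_gt0 //].
  by move=> x y x0 y0; rewrite muln_gt0 x0.
- rewrite big_seq; elim/big_ind: _ => [|x y cx cy|q qr]; first exact: coprimen1.
    by rewrite coprimeMr cx cy.
  rewrite prime_coprime // dvdn_prime2 //; last exact: (allP pr).
  by apply: contra pNr => /eqP->.
- by move=> n; apply: perW.
Qed.

(** [E] is the mean of [u] over a period. Complete periods cancel exactly; the incomplete one and
    its expected value contribute at most [Q] each. *)
Lemma sum_periodic_approx (R : realFieldType) (u : nat -> R) (Q X : nat) (E : R) :
  (0 < Q)%N -> (forall n, u (n + Q)%N = u n) -> (forall n, `|u n| <= 1) ->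
  \sum_(n < Q) u n = Q%:R * E ->
  `|\sum_(n < X) u n - X%:R * E| <= 2 * Q%:R.
Proof.
move=> Q0 uQ u1 sE.
have E1 : `|E| <= 1.
  have : `|Q%:R * E| <= Q%:R.
    rewrite -sE (le_trans (ler_norm_sum _ _ _)) //.
    rewrite (le_trans (ler_sum _ (fun i _ => u1 _))) //.
    by rewrite sumr_const card_ord.
  by rewrite normrM ger0_norm // ger_pMr // ltr0n.
have eX : X = (X %/ Q * Q + X %% Q)%N := divn_eq X Q.
have rQ : ((X %% Q)%N%:R <= Q%:R :> R) by rewrite ler_nat ltnW // ltn_pmod.
move: (X %/ Q)%N (X %% Q)%N eX rQ => k r eX rQ.
rewrite eX big_split_ord /= sum_periodic // sE natrD natrM.
have -> : (Q%:R * E) *+ k + \sum_(i < r) u (k * Q + i)%N - (k%:R * Q%:R + r%:R) * E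
        = \sum_(i < r) u (k * Q + i)%N - r%:R * E by rewrite -mulr_natl; ring.
rewrite (le_trans (ler_normB _ _)) // (_ : 2 * Q%:R = Q%:R + Q%:R); last by ring.
apply: lerD.
  rewrite (le_trans _ rQ) // (le_trans (ler_norm_sum _ _ _)) //.
  rewrite (le_trans (ler_sum _ (fun i _ => u1 _))) //.
  by rewrite sumr_const card_ord.
rewrite normrM ger0_norm // (le_trans _ rQ) //.
by rewrite ler_piMr.
Qed.

Lemma sum_prod_crt_set (R : comPzRingType) (n : nat) (u : 'I_n -> nat -> R)
    (A : {set 'I_n}) :
  {in A, forall i : 'I_n, prime i} ->
  {in A, forall (i : 'I_n) m, u i (m + i)%N = u i m} ->
  \sum_(m < (\prod_(i in A) i)%N) \prod_(i in A) u i m =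
    \prod_(i in A) \sum_(m < i) u i m.
Proof.
move=> pA perA.
(* [u] lives on ['I_n], where squarefree numbers are encoded as sets of primes; [v] extends it by 0
   to [nat]. *)
pose v p m := if insub p is Some i then u i m else 0.
have vE (i : 'I_n) m : v i m = u i m by rewrite /v valK.
have eqA (T : Type) (op : SemiGroup.com_law T) (x : T) (F : nat -> T) :
    \big[op/x]_(p <- [seq val i | i <- enum A]) F p = \big[op/x]_(i in A) F (val i).
  by rewrite big_map big_enum.
have := @sum_prod_crt R v [seq val i | i <- enum A].
rewrite !eqA map_inj_uniq ?enum_uniq; last exact: val_inj.
move=> /(_ isT) H; have {}H := H _ _.
rewrite (eq_bigr (fun m : 'I__ => \prod_(i in A) v i m)); last first.
  by move=> m _; apply: eq_bigr => i _; rewrite vE.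
transitivity (\prod_(i in A) \sum_(m < i) v i m); last first.
  by apply: eq_bigr => i _; apply: eq_bigr => m _; rewrite vE.
rewrite -H.
- by apply: eq_bigr => m _; rewrite eqA.
- by apply/allP => p /mapP[i]; rewrite mem_enum => /pA pi ->.
- by move=> p /mapP[i]; rewrite mem_enum => iA -> m; rewrite !vE perA.
Qed.

Lemma prod_primes_inj (n : nat) (A B : {set 'I_n}) :
  {in A, forall i : 'I_n, prime i} -> {in B, forall i : 'I_n, prime i} ->
  (\prod_(i in A) i = \prod_(i in B) i)%N -> A = B.
Proof.
have sub (C D : {set 'I_n}) : {in C, forall i : 'I_n, prime i} ->
    {in D, forall i : 'I_n, prime i} ->
    (\prod_(i in C) i = \prod_(i in D) i)%N -> C \subset D.
  move=> pC pD e; apply/fintype.subsetP => i iC.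
  have : (i %| \prod_(j in D) j)%N by rewrite -e (bigD1 i) //= dvdn_mulr.
  rewrite Euclid_dvd_prod ?pC // big_orE => /existsP[j /andP[jD]].
  by rewrite dvdn_prime2 ?(pC _ iC) ?(pD _ jD) // => /eqP/val_inj ->.
by move=> pA pB e; apply/eqP; rewrite finset.eqEsubset !sub.
Qed.

(* Turán's variance method over an orthogonal system: X_p is centred modulo p,
   with variance h p, and equals h p on the sifted set; hence the sum of
   \prod_(i in A) X_i over A in LL is L there, while its mean square is L. *)
Lemma large_sieve (R : realFieldType) (n : nat) (LL : {set {set 'I_n}})
    (Om : nat -> nat -> bool) (w : nat -> nat) (z X : nat) (S : pred nat) (L : R) :
  (forall A i, A \in LL -> i \in A -> prime i) ->
  (forall p m, prime p -> Om p (m + p)%N = Om p m) ->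
  (forall p, prime p -> (\sum_(m < p) Om p m)%N = w p) ->
  (forall p, prime p -> (2 * w p <= p)%N) ->
  (forall A, A \in LL -> (\prod_(i in A) i <= z)%N) ->
  (forall m A i, (m < X)%N -> S m -> A \in LL -> i \in A -> ~~ Om i m) ->
  L = \sum_(A in LL) \prod_(i in A) ((w i)%:R / (i%:R - (w i)%:R)) ->
  (\sum_(m < X | S m) 1)%N%:R * L ^+ 2 <= X%:R * L + 2 * z%:R ^+ 4.
Proof.
move=> pLL perO sO wle zLL SO LE0.
(* With the value -1 on the removed classes, [h p] is the value elsewhere that makes the sum over a
   period vanish. *)
pose h p : R := (w p)%:R / (p%:R - (w p)%:R).
have LE : L = \sum_(A in LL) \prod_(i in A) h i := LE0.
pose x p m : R := if Om p m then -1 else h p.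
pose xA (A : {set 'I_n}) m := \prod_(i in A) x i m.
have wlt p : prime p -> (w p)%:R < p%:R :> R.
  move=> pp; rewrite ltr_nat; have := wle _ pp; have := prime_gt0 pp; lia.
have d_gt0 p : prime p -> 0 < p%:R - (w p)%:R :> R by move=> /wlt; rewrite subr_gt0.
have h_ge0 p : prime p -> 0 <= h p by move=> /d_gt0/ltW d0; rewrite divr_ge0.
have h_le1 p : prime p -> h p <= 1.
  move=> pp; rewrite ler_pdivrMr ?d_gt0 // mul1r lerBrDr.
  by rewrite -natrD ler_nat addnn -mul2n wle.
have x_le1 p m : prime p -> `|x p m| <= 1.
  move=> pp; rewrite /x; case: ifP; first by rewrite normrN1.
  by rewrite ger0_norm ?h_ge0 ?h_le1.
have xper p m : prime p -> x p (m + p)%N = x p m by move=> pp; rewrite /x perO.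
have sx (p : nat) (a b : R) : prime p -> \sum_(m < p) (if Om p m then a else b)
    = (w p)%:R * a + (p%:R - (w p)%:R) * b.
  move=> pp.
  rewrite (eq_bigr (fun m : 'I_p => (Om p m)%:R * (a - b) + b)); last first.
    by move=> m _; case: (Om p m) => /=; ring.
  rewrite big_split /= -mulr_suml -natr_sum sO // sumr_const card_ord -mulr_natl; ring.
have sx1 p : prime p -> \sum_(m < p) x p m = 0.
  move=> pp; rewrite sx // /h; field.
  by rewrite gt_eqF ?d_gt0.
have sx2 p : prime p -> \sum_(m < p) x p m * x p m = p%:R * h p.
  move=> pp.
  rewrite (eq_bigr (fun m : 'I_p => if Om p m then 1 else h p * h p)); last first.
    by move=> m _; rewrite /x; case: (Om p m) => //; ring.
  rewrite sx // /h; field.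
  by rewrite gt_eqF ?d_gt0.
(* Orthogonality: a prime in exactly one of [A] and [B] contributes a factor [\sum x p = 0]; for
   [A = B] the factors are the second moments [p * h p]. *)
have corr A B : A \in LL -> B \in LL ->
    \sum_(m < (\prod_(i in A :|: B) i)%N) xA A m * xA B m =
    (\prod_(i in A :|: B) i)%N%:R * (if A == B then \prod_(i in A) h i else 0).
  move=> AL BL.
  pose y (i : 'I_n) m := (if i \in A then x i m else 1) * (if i \in B then x i m else 1).
  have pAB : {in A :|: B, forall i : 'I_n, prime i}.
    by move=> i; rewrite inE => /orP[]; apply: pLL.
  have xAE (C : {set 'I_n}) m : C \subset A :|: B ->
      xA C m = \prod_(i in A :|: B) (if i \in C then x i m else 1).
    move=> sC; rewrite -big_mkcondr; apply: eq_bigl => i.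
    by rewrite andb_idl // => /(fintype.subsetP sC).
  rewrite (eq_bigr (fun m : 'I__ => \prod_(i in A :|: B) y i m)); last first.
    by move=> m _; rewrite !xAE ?finset.subsetUl ?finset.subsetUr // -big_split.
  rewrite sum_prod_crt_set //; last first.
    by move=> i iAB m; rewrite /y !xper // pAB.
  have [eAB|neAB] := eqVneq A B.
    rewrite eAB finset.setUid natr_prod -big_split; apply: eq_bigr => i iB /=.
    by rewrite /y eAB iB sx2 // (pLL B).
  have [i iAB iN] : exists2 i, i \in A :|: B & (i \in A) != (i \in B).
    apply/exists_inP; apply: contraNT neAB => /exists_inPn nAB.
    apply/eqP/finset.setP => i; have := nAB i; rewrite inE.
    by case: (i \in A); case: (i \in B) => //= /(_ isT).
  rewrite mulr0 (bigD1 i) //=; suff -> : \sum_(m < i) y i m = 0 by rewrite mul0r.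
  rewrite -[RHS](sx1 i) ?pAB //; apply: eq_bigr => m _.
  by rewrite /y; case: (i \in A) iN; case: (i \in B) => //= _; rewrite ?mul1r ?mulr1.
have xA_le1 A m : A \in LL -> `|xA A m| <= 1.
  move=> AL; rewrite normr_prod; apply: prodr_ile1 => i iA.
  by rewrite normr_ge0 x_le1 // (pLL A).
have zz A B : A \in LL -> B \in LL -> (\prod_(i in A :|: B) i <= z * z)%N.
  move=> AL BL; rewrite (leq_trans _ (leq_mul (zLL _ AL) (zLL _ BL))) //.
  rewrite (big_setID A) /= finset.setIUl finset.setIid (finset.setUidPl _) ?finset.subsetIr //.
  rewrite leq_mul2l; apply/orP; right.
  rewrite finset.setDUl finset.setDv finset.set0U [leqRHS](big_setID A) /= leq_pmull //.
  by apply: prodn_cond_gt0 => i /finset.setIP[iB _]; rewrite prime_gt0 // (pLL B).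
(* By unique factorisation the products embed [LL] into the integers from 1 to [z]. *)
have cLL : (#|LL| <= z)%N.
  have inj : {in LL &, injective (fun A : {set 'I_n} => (\prod_(i in A) i)%N)}.
    by move=> A B AL BL /=; apply: prod_primes_inj => i; apply: pLL.
  rewrite cardE -(size_map (fun A : {set 'I_n} => (\prod_(i in A) i)%N)) -(size_iota 1 z).
  apply: uniq_leq_size.
    rewrite map_inj_in_uniq ?enum_uniq // => A B; rewrite !mem_enum; exact: inj.
  move=> q /mapP[A]; rewrite mem_enum => AL ->; rewrite mem_iota add1n ltnS zLL // andbT.
  by apply: prodn_cond_gt0 => i iA; rewrite prime_gt0 // (pLL A).
have L_ge : (\sum_(m < X | S m) 1)%N%:R * L ^+ 2 <= \sum_(m < X) (\sum_(A in LL) xA A m) ^+ 2.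
  rewrite natr_sum mulr_suml [leRHS](bigID (fun m : 'I_X => S m)) /=.
  rewrite -[leLHS]addr0 lerD //; last by apply: sumr_ge0 => m _; rewrite sqr_ge0.
  apply: ler_sum => m Sm; rewrite mul1r le_eqVlt; apply/orP; left; apply/eqP.
  congr (_ ^+ 2); rewrite LE; apply: eq_bigr => A AL; apply: eq_bigr => i iA.
  by rewrite /x (negbTE (SO m A i (ltn_ord m) Sm AL iA)).
apply: le_trans L_ge _.
rewrite (eq_bigr (fun m : 'I_X => \sum_(A in LL) \sum_(B in LL) xA A m * xA B m)); last first.
  by move=> m _; rewrite expr2 big_distrlr.
rewrite exchange_big /= (eq_bigr (fun A => \sum_(B in LL) \sum_(m < X) xA A m * xA B m)); last first.
  by move=> A _; rewrite exchange_big.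
(* The period is at most [z * z], which bounds the error of one pair; summing over at most [z ^ 2]
   pairs gives [2 * z ^ 4]. *)
have bnd A B : A \in LL -> B \in LL -> \sum_(m < X) xA A m * xA B m <=
    X%:R * (if A == B then \prod_(i in A) h i else 0) + 2 * (z * z)%N%:R.
  move=> AL BL; rewrite addrC -lerBlDr.
  have Q0 : (0 < \prod_(i in A :|: B) i)%N.
    apply: prodn_cond_gt0 => i /finset.setUP[] iA; rewrite prime_gt0 //.
      exact: (pLL A).
    exact: (pLL B).
  have := @sum_periodic_approx R (fun m => xA A m * xA B m) _ X _ Q0 _ _ (corr A B AL BL).
  move=> H; apply: le_trans (ler_norm _) (le_trans (H _ _) _).
  - move=> m; congr (_ * _); apply: eq_bigr => i iA.
      have /dvdnP[k ->] : (i %| \prod_(i in A :|: B) i)%N.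
        by rewrite (bigD1 i) /= ?dvdn_mulr // inE iA.
      rewrite addnC; elim: k => // k IHk.
      by rewrite mulSn -addnA addnC xper // (pLL A).
    have /dvdnP[k ->] : (i %| \prod_(i in A :|: B) i)%N.
      by rewrite (bigD1 i) /= ?dvdn_mulr // inE iA orbT.
    rewrite addnC; elim: k => // k IHk.
    by rewrite mulSn -addnA addnC xper // (pLL B).
  - by move=> m; rewrite normrM mulr_ile1 // xA_le1.
  - by rewrite ler_pM2l ?ltr0n // ler_nat zz.
apply: (@le_trans _ _ (\sum_(A in LL) \sum_(B in LL)
    (X%:R * (if A == B then \prod_(i in A) h i else 0) + 2 * (z * z)%N%:R))).
  by apply: ler_sum => A AL; apply: ler_sum => B BL; apply: bnd.
rewrite (eq_bigr (fun A : {set 'I_n} => X%:R * (\prod_(i in A) h i) + #|LL|%:R * (2 * (z * z)%N%:R))); last first.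
  move=> A AL; rewrite big_split /= sumr_const -(mulr_natl (2 * _)); congr (_ + _).
  rewrite (bigD1 A) //= eqxx [X in _ + X]big1 ?addr0 // => B /andP[_ /negbTE].
  by rewrite eq_sym => ->; rewrite mulr0.
rewrite big_split /= -mulr_sumr ?mulr1 LE lerD2l sumr_const -[leLHS]mulr_natl.
have cz : #|LL|%:R <= z%:R :> R by rewrite ler_nat.
rewrite natrM; have -> : 2 * z%:R ^+ 4 = z%:R * (z%:R * (2 * (z%:R * z%:R))) :> R by ring.
have z2 : 0 <= 2 * (z%:R * z%:R) :> R by rewrite !mulr_ge0.
apply: ler_pM => //; first by rewrite mulr_ge0.
by apply: ler_wpM2r.
Qed.

(** * Chebyshev's lower bound *)

(** By Pascal's rule the next central coefficient is a sum of two terms, each at least the current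
    one. *)
Lemma exp2_le_central_bin (n : nat) : (2 ^ n <= 'C(n.*2, n))%N.
Proof.
elim: n => [//|n IHn]; rewrite doubleS expnS mul2n -addnn binS.
apply: leq_add; apply: leq_trans IHn _.
  by rewrite binS leq_addl.
by case: n => [//|n]; rewrite binS leq_addr.
Qed.

(* By Legendre's formula each power p ^ k <= 2 n contributes at
   most 1 to the exponent of p in 'C(2 n, n). *)
Lemma logn_central_bin_le (p n : nat) :
  (0 < n)%N -> prime p -> (p ^ logn p 'C(n.*2, n) <= n.*2)%N.
Proof.
move=> n0 pp.
have C0 : (0 < 'C(n.*2, n))%N by rewrite bin_gt0 -addnn leq_addr.
have e : logn p (n.*2)`! = (logn p 'C(n.*2, n) + (logn p n`!).*2)%N.
  rewrite -(@bin_fact n.*2 n) -addnn ?leq_addr // addnK addnn.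
  by rewrite !lognM ?muln_gt0 ?fact_gt0 // addnn.
have ext : logn p n`! = (\sum_(1 <= k < (n.*2).+1) n %/ p ^ k)%N.
  rewrite logn_fact // [RHS](big_cat_nat (n := n.+1)) //= ?ltnS -?addnn ?leq_addr //.
  rewrite [X in (_ + X)%N]big_nat_cond [X in (_ + X)%N]big1 ?addn0 // => k /andP[/andP[nk _] _].
  by rewrite divn_small // (ltn_trans _ (ltn_expl k (prime_gt1 pp))).
(* The [k]-th Legendre term of [(2 n)!] exceeds twice that of [n!] by at most 1, and by 0 once
   [p ^ k > 2 n]. *)
have le_t : (logn p 'C(n.*2, n) <= \sum_(1 <= k < (n.*2).+1) (p ^ k <= n.*2))%N.
  rewrite -(leq_add2r (logn p n`!).*2) -e logn_fact // ext -(mul2n (\sum_(1 <= k < _) _ %/ _)) big_distrr /= -big_split /=.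
  apply: leq_sum => k _; case: (leqP (p ^ k) n.*2) => H; last by rewrite divn_small.
  have pk : (0 < p ^ k)%N by rewrite expn_gt0 prime_gt0.
  rewrite -[nat_of_bool true]/1%N add1n -ltnS ltn_divLR //.
  have := divn_eq n (p ^ k); have := ltn_pmod n pk; nia.
apply: leq_trans (_ : p ^ trunc_log p n.*2 <= _)%N; last first.
  by rewrite trunc_logP ?prime_gt1 // double_gt0.
rewrite leq_exp2l ?prime_gt1 // (leq_trans le_t) //.
rewrite (eq_big_nat _ _ (F2 := fun k => (k <= trunc_log p n.*2)%N : nat)); last first.
  move=> k _; congr nat_of_bool; apply/idP/idP => H.
    by rewrite trunc_log_max ?prime_gt1.
  by rewrite (leq_trans _ (trunc_logP (prime_gt1 pp) _)) ?double_gt0 // leq_exp2l ?prime_gt1.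
have aux m t : (\sum_(1 <= k < m.+1) (k <= t)%N = minn m t)%N.
  elim: m => [|m IHm]; first by rewrite big_geq // min0n.
  rewrite big_nat_recr //= IHm; case: leqP => /=; lia.
by rewrite aux geq_minr.
Qed.

(** Each prime power exactly dividing the binomial coefficient is at most [2 n], so only primes up
    to [2 n] occur, with a factor of at most [2 n] each. *)
Lemma central_bin_le (n : nat) : (0 < n)%N -> ('C(n.*2, n) <= n.*2 ^ primepi n.*2)%N.
Proof.
move=> n0; set C := 'C(_, _).
have C0 : (0 < C)%N by rewrite bin_gt0 -addnn leq_addr.
rewrite -{1}(partnT C0) (widen_partn predT (leq_maxl C n.*2)).
have -> : (n.*2 ^ primepi n.*2 = \prod_(0 <= p < n.*2.+1 | prime p) n.*2)%N.
  by rewrite /primepi expn_sum.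
rewrite [leqRHS](big_nat_widen _ _ (maxn C n.*2).+1) ?ltnS ?leq_maxr //.
rewrite big_mkcond [leqRHS]big_mkcond /=. apply: leq_prod => p _; rewrite ltnS.
have [pp /=|npp /=] := boolP (prime p); last by rewrite lognE (negbTE npp).
have le := logn_central_bin_le n0 pp; case: (leqP p n.*2) => // ltp.
case e : (logn p C) => [//|k]; move: le; rewrite -/C e leqNgt => /negP[].
by rewrite (leq_trans ltp) // expnS leq_pmulr // expn_gt0 prime_gt0.
Qed.

(** [J] bounds the binary logarithm of [x]. With [n] the half of [x] rounded down, the two bounds on
    the central coefficient give [n <= J * primepi x], and [x <= 2 n + 1 <= 3 n]. *)
Lemma chebyshev_lower (x J : nat) : (2 <= x)%N -> (x < 2 ^ J)%N -> (x <= 3 * J * primepi x)%N.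
Proof.
move=> x2 xJ; pose n := (x./2)%N.
have n0 : (0 < n)%N by rewrite /n; lia.
have nx : (n.*2 <= x)%N by rewrite /n; lia.
have : (2 ^ n <= 2 ^ (J * primepi x))%N.
  rewrite (leq_trans (exp2_le_central_bin n)) // (leq_trans (central_bin_le n0)) //.
  rewrite expnM (@leq_trans (n.*2 ^ primepi x)) //.
    rewrite leq_pexp2l ?double_gt0 // /primepi [leqRHS](big_cat_nat (n := n.*2.+1)) //=.
    exact: leq_addr.
  by case: (primepi x) => [|k]; rewrite ?expn0 ?leq_exp2r ?(ltnW (leq_ltn_trans nx xJ)).
rewrite leq_exp2l // /n; lia.
Qed.

(** * Sums over squarefree numbers *)

(** Each dyadic block contributes at least 1/2. *)
Lemma sum_harmonic_exp2 (R : realFieldType) (j : nat) :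
  j%:R / 2 <= \sum_(1 <= n < (2 ^ j).+1) n%:R^-1 :> R.
Proof.
elim: j => [|j IHj].
  by rewrite mul0r; apply: sumr_ge0 => n _; rewrite invr_ge0.
have le12 : (2 ^ j <= 2 ^ j.+1)%N by rewrite leq_exp2l.
rewrite (big_cat_nat (n := (2 ^ j).+1)) //= -natr1 mulrDl; apply: lerD => //.
apply: (@le_trans _ _ (\sum_((2 ^ j).+1 <= n < (2 ^ j.+1).+1) (2 ^ j.+1)%:R^-1)).
  rewrite sumr_const_nat subSS (_ : (2 ^ j.+1 - 2 ^ j = 2 ^ j)%N); last first.
    by rewrite expnS mul2n -addnn addnK.
  rewrite -mulr_natl expnS natrM le_eqVlt; apply/orP; left; apply/eqP.
  by field; rewrite pnatr_eq0 expn_eq0.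
apply: ler_sum_nat => n /andP[n1 n2].
by rewrite lef_pV2 ?posrE ?ltr0n ?ler_nat ?expn_gt0 // (leq_ltn_trans _ n1).
Qed.

(** The sharper bound [2 - 1 / Z] telescopes. *)
Lemma sum_inv_sqr_le2 (R : realFieldType) (Z : nat) :
  \sum_(1 <= k < Z.+1) (k%:R ^+ 2)^-1 <= 2 :> R.
Proof.
case: Z => [|Z]; first by rewrite big_geq.
suff : \sum_(1 <= k < Z.+2) (k%:R ^+ 2)^-1 <= 2 - (Z.+1)%:R^-1 :> R.
  by move/le_trans; apply; rewrite gerBl invr_ge0.
elim: Z => [|Z IHZ]; first by rewrite big_nat1 expr1n invr1; lra.
rewrite big_nat_recr //= (le_trans (lerD IHZ (lexx _))) // -lerBrDl.
rewrite -(natr1 Z.+1).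
have : 0 < Z.+1%:R :> R by rewrite ltr0n.
move: (Z.+1%:R : R) => {IHZ} a a0.
have a1 : 0 < a + 1 by rewrite addr_gt0.
have -> : 2 - (a + 1)^-1 - (2 - a^-1) = (a * (a + 1))^-1.
  by field; rewrite !gt_eqF.
rewrite lef_pV2 ?posrE ?exprn_gt0 ?mulr_gt0 // expr2 ler_pM2r //; lra.
Qed.

(** [A] collects the primes of odd exponent in [m]; [k] carries half of every exponent, rounded
    down. *)
Lemma squarefree_decomp (n m : nat) :
  (0 < m < n)%N ->
  exists2 A : {set 'I_n}, {in A, forall i : 'I_n, prime i} &
    exists k, m = ((\prod_(i in A) i) * k ^ 2)%N.
Proof.
move=> /andP[m0 mn].
exists [set i : 'I_n | prime i & odd (logn i m)].
  by move=> i; rewrite inE => /andP[].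
exists (\prod_(i < n | prime i) i ^ (logn i m)./2)%N.
have mE : m = (\prod_(i < n | prime i) i ^ logn i m)%N.
  case: n mn => // n; rewrite ltnS => mn.
  rewrite -{1}(partnT m0) (widen_partn predT mn) big_mkord [RHS]big_mkcond /=.
  by apply: eq_bigr => i _; case: ifPn => // /negbTE np; rewrite lognE np.
rewrite {1}mE -mulnn -big_split /=.
have -> : (\prod_(i in [set i : 'I_n | prime i & odd (logn i m)]) i =
    \prod_(i < n | prime i) i ^ odd (logn i m))%N.
  rewrite [RHS]big_mkcond /= big_mkcond /=; apply: eq_bigr => i _; rewrite inE.
  by case: (prime i); case: (odd _); rewrite ?expn1.
rewrite -big_split; apply: eq_bigr => i _ /=.
by rewrite -!expnD addnn odd_double_half.
Qed.

(** Every [m] is a squarefree number times a square [k ^ 2], and the sum of [1 / k ^ 2] is at most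
    2. *)
Lemma sum_inv_le_sum_squarefree (R : realFieldType) (n Z : nat) (LL : {set {set 'I_n}}) :
  (Z < n)%N -> (forall A, A \in LL -> {in A, forall i : 'I_n, prime i}) ->
  (forall A : {set 'I_n}, {in A, forall i : 'I_n, prime i} ->
     (\prod_(i in A) i <= Z)%N -> A \in LL) ->
  \sum_(1 <= m < Z.+1) m%:R^-1 <= 2 * \sum_(A in LL) \prod_(i in A) (i%:R^-1) :> R.
Proof.
move=> Zn pLL LLZ.
have pi0 A : A \in LL -> (0 < \prod_(i in A) i)%N.
  by move=> AL; apply: prodn_cond_gt0 => i iA; rewrite prime_gt0 // (pLL A).
have inv0 (A : {set 'I_n}) : 0 <= \prod_(i in A) (i%:R^-1) :> R by apply: prodr_ge0 => i _; rewrite invr_ge0.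
pose c (A : {set 'I_n}) k := ((\prod_(i in A) i) * k ^ 2)%N.
(* The indicator of [m = c A k] allows the sums to be exchanged; each [m] is hit by at least one
   pair. *)
apply: (@le_trans _ _ (\sum_(A in LL) \sum_(1 <= k < Z.+1) \sum_(1 <= m < Z.+1)
    (if m == c A k then m%:R^-1 else 0))); last first.
  rewrite mulr_sumr; apply: ler_sum => A AL.
  rewrite mulrC; apply: le_trans (ler_wpM2l (inv0 A) (sum_inv_sqr_le2 R Z)).
  rewrite mulr_sumr; apply: ler_sum_nat => k /andP[k0 kZ].
  have cE : (c A k)%:R^-1 = \prod_(i in A) (i%:R^-1) * (k%:R ^+ 2)^-1 :> R.
    by rewrite /c natrM natrX invfM natr_prod prodfV.
  rewrite -cE -big_mkcond /=.
  have [lt|le] := ltnP (c A k) Z.+1.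
    by rewrite big_nat1_eq; case: ifP => _; rewrite ?invr_ge0.
  rewrite big_nat_cond big1 ?invr_ge0 // => m /andP[/andP[_ mZ] /eqP e].
  by move: le; rewrite -e leqNgt mZ.
rewrite (eq_bigr (fun A : {set 'I_n} => \sum_(1 <= m < Z.+1) \sum_(1 <= k < Z.+1)
    (if m == c A k then m%:R^-1 else 0))); last by move=> A _; rewrite exchange_big.
rewrite exchange_big /=; apply: ler_sum_nat => m /andP[m0 mZ].
have [|A pA [k mE]] := @squarefree_decomp n m; first by rewrite m0 (leq_ltn_trans _ Zn).
have k0 : (0 < k)%N by case: k mE => // mE; move: m0; rewrite mE muln0.
have A0 : (0 < \prod_(i in A) i)%N.
  by apply: prodn_cond_gt0 => i iA; rewrite prime_gt0 // pA.
have AL : A \in LL.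
  by apply: LLZ => //; rewrite -ltnS (leq_ltn_trans _ mZ) // mE leq_pmulr // expn_gt0 k0.
have t0 B l : 0 <= (if m == c B l then m%:R^-1 else 0) :> R by case: ifP; rewrite ?invr_ge0.
rewrite (bigD1 A) //= -[leLHS]addr0; apply: lerD; last first.
  by apply: sumr_ge0 => B _; apply: sumr_ge0 => l _.
have kZ : k \in index_iota 1 Z.+1.
  rewrite mem_index_iota k0 /= (leq_ltn_trans _ mZ) // mE.
  by rewrite (leq_trans _ (leq_pmull _ A0)) // expnS expn1 leq_pmulr.
rewrite (big_rem k) //= /c -mE eqxx lerDl; apply: sumr_ge0 => l _; exact: (t0 A l).
Qed.

Lemma sum_prod_subset (R : comPzRingType) (I : finType) (FS : {set I}) (g : I -> R) :
  \sum_(A : {set I} | A \subset FS) \prod_(i in A) g i = \prod_(i in FS) (1 + g i).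
Proof.
rewrite [RHS]big_mkcond /=.
rewrite (eq_bigr (fun i => (if i \in FS then g i else 0) + 1)); last first.
  by move=> i _; case: ifP; rewrite ?add0r // addrC.
rewrite bigA_distr [RHS](bigID (fun A : {set I} => A \subset FS)) /=.
rewrite [X in _ + X]big1 ?addr0; last first.
  by move=> A /subsetPn[i iA iF]; rewrite (bigD1 i) //= iA (negbTE iF) mul0r.
apply: eq_bigr => A /fintype.subsetP AF; rewrite -big_mkcond /=.
by apply: eq_bigr => i /AF ->.
Qed.

(** [A :&: FS] is unconstrained and yields an Euler product over [FS]; only [A :\: FS] is subject to
    [Q]. *)
Lemma sum_prod_split (R : comPzRingType) (I : finType) (FS : {set I})
    (Q : pred {set I}) (g : I -> R) :
  \sum_(A : {set I} | Q (A :\: FS)) \prod_(i in A) g i =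
  \prod_(i in FS) (1 + g i) * \sum_(A : {set I} | [disjoint A & FS] && Q A) \prod_(i in A) g i.
Proof.
rewrite -sum_prod_subset big_distrlr /= pair_big /=.
rewrite (reindex_onto (fun p : {set I} * {set I} => p.1 :|: p.2)
  (fun A => (A :&: FS, A :\: FS))) /=; last by move=> A _; rewrite finset.setID.
apply: eq_big => [[A B]|[A B]] /=.
  apply/andP/and3P.
    move=> [QD /eqP[eA eB]]; rewrite -{1}eA finset.subsetIr; split => //.
      by rewrite -eB -finset.setI_eq0 finset.setIDAC finset.setDIl finset.setDv finset.setI0.
    by rewrite -eB.
  move=> [AF dB QB].
  have eB : (A :|: B) :\: FS = B.
    rewrite finset.setDUl (_ : A :\: FS = finset.set0) ?finset.set0U; last first.
      by apply/eqP; rewrite finset.setD_eq0.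
    by apply/finset.setDidPl.
  have eA : (A :|: B) :&: FS = A.
    rewrite finset.setIUl (finset.setIidPl AF) (_ : B :&: FS = finset.set0) ?finset.setU0 //.
    by apply/eqP; rewrite finset.setI_eq0.
  by rewrite eB eA.
move=> /andP[_ /eqP[eA eB]].
rewrite (big_setID FS) /= eA eB //.
Qed.

(** * Sieving shifted integers and shifted primes *)

Lemma count_upto_le (P Q : nat -> Prop) (x : nat) :
  (forall q, P q -> Q q) -> (count_upto P x <= count_upto Q x)%N.
Proof.
move=> PQ; rewrite /count_upto big_mkcond [leqRHS]big_mkcond /=.
apply: leq_sum => q _; case: asboolP => // /PQ Qq; by case: asboolP.
Qed.

Lemma count_upto_or (P Q : nat -> Prop) (x : nat) :
  (count_upto (fun q => P q \/ Q q) x <= count_upto P x + count_upto Q x)%N.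
Proof.
rewrite /count_upto !(big_mkcond (fun q => `[< _ >])) -big_split /=.
apply: leq_sum => q _; do 3 case: asboolP => //; tauto.
Qed.

Lemma count_upto_split (P Q : nat -> Prop) (x : nat) :
  (count_upto P x = count_upto (fun q => P q /\ Q q) x
                    + count_upto (fun q => P q /\ ~ Q q) x)%N.
Proof.
rewrite /count_upto !(big_mkcond (fun q => `[< _ >])) -big_split /=.
apply: eq_bigr => q _; do 3 case: asboolP => //; tauto.
Qed.

Lemma count_upto_lt (m x : nat) : (count_upto (fun q => (q < m)%N) x <= m)%N.
Proof.
suff -> : count_upto (fun q => (q < m)%N) x = minn x m.-1 by lia.
rewrite /count_upto; elim: x => [|x IHx]; first by rewrite big_geq // min0n.
rewrite big_mkcond big_nat_recr //= -big_mkcond /= IHx asboolb.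
case: ltnP; lia.
Qed.

Lemma count_upto_true (x : nat) : count_upto (fun=> True) x = x.
Proof.
rewrite /count_upto (eq_bigl xpredT) => [|q]; last exact: asboolT.
by rewrite sum_nat_const_nat muln1 subn1.
Qed.

Lemma count_upto_prime (x : nat) : count_upto (fun q => prime q) x = primepi x.
Proof.
rewrite /count_upto /primepi [RHS]big_ltn_cond //=.
by apply: eq_bigl => q; rewrite asboolb.
Qed.

Lemma count_upto_le_sum (P : nat -> Prop) (x : nat) :
  (count_upto P x <= \sum_(m < x.+1 | `[< P m >]) 1)%N.
Proof.
rewrite -(big_mkord (fun m => `[< P m >]) (fun=> 1%N)) [leqRHS]big_ltn_cond //.
by case: ifP => _; rewrite ?leq_addl ?leqnn.
Qed.

Definition density_le (R : realType) (P E : nat -> Prop) (eps : R) : Prop :=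
  exists x0 : nat, forall x : nat, (x0 <= x)%N ->
    (count_upto (fun q => P q /\ E q) x)%:R <= eps * (count_upto P x)%:R.

(** The only analytic input about the set [P] in which [q] varies, so that integers and primes can
    be treated together afterwards. For primes [q], [p] not dividing [s] keeps the classes 0 and
    [- s] modulo [p] apart, and [4 < p] leaves room to remove both. *)
Definition shift_sievable (R : realType) (P : nat -> Prop) : Prop :=
  forall (s : int) (eps : R), s != 0 -> 0 < eps -> exists B : R, forall F : seq nat,
    uniq F -> all prime F ->
    (forall p, p \in F -> (4 < p)%N /\ ~ (p%:Z %| s)%Z) ->
    B <= \sum_(p <- F) p%:R^-1 ->
    density_le P (fun q => forall p, p \in F -> ~ (p%:Z %| q%:Z + s)%Z) eps.

Lemma count_residue (p : nat) (s : int) : prime p ->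
  (\sum_(m < p) (p%:Z %| (m%:Z + s)%R)%Z = 1)%N.
Proof.
move=> pp; have p0 : p%:Z != 0 by rewrite -lt0n prime_gt0.
pose r := (- s %% p%:Z)%Z.
have r0 : 0 <= r by rewrite modz_ge0.
have rp : (`|r| < p)%N by rewrite -ltz_nat gez0_abs // ltz_mod.
rewrite (eq_bigr (fun m => (m == Ordinal rp) : nat)) => [|m _].
  by rewrite -big_mkcond /= big_pred1_eq.
congr nat_of_bool; rewrite -[s in LHS]opprK -eqz_mod_dvd modz_small; last first.
  by rewrite le0z_nat ltz_nat ltn_ord.
by rewrite -val_eqE /= -eqz_nat gez0_abs.
Qed.

Lemma dvdz_shift_periodic (p m : nat) (s : int) :
  (p%:Z %| (m + p)%N%:Z + s)%Z = (p%:Z %| m%:Z + s)%Z.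
Proof. by rewrite PoszD addrAC rpredDr ?dvdzz. Qed.

Lemma big_uniq_ord (T : Type) (idx : T) (op : Monoid.com_law idx) (n : nat)
    (F : seq nat) (f : nat -> T) :
  uniq F -> (forall p, p \in F -> (p < n)%N) ->
  \big[op/idx]_(p <- F) f p = \big[op/idx]_(i in [set i : 'I_n | val i \in F]) f (val i).
Proof.
move=> uF Fn.
have pF : perm_eq F [seq val i | i <- enum [set i : 'I_n | val i \in F]].
  apply: uniq_perm => //.
    by rewrite map_inj_uniq ?enum_uniq //; exact: val_inj.
  move=> p; apply/idP/mapP => [pF|[i]]; last by rewrite mem_enum inE => ? ->.
  by exists (Ordinal (Fn _ pF)) => //; rewrite mem_enum inE.
by rewrite (perm_big _ pF) big_map big_enum.
Qed.

Lemma sum_singletons (R : realFieldType) (n : nat) (F : seq nat) (g : nat -> R) :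
  uniq F -> (forall p, p \in F -> (p < n)%N) ->
  \sum_(A in [set [set i : 'I_n] | i in [set i : 'I_n | val i \in F]]) \prod_(i in A) g i
   = \sum_(p <- F) g p.
Proof.
move=> uF Fn; rewrite big_imset /=; last by move=> i j _ _ /finset.set1_inj.
by under eq_bigr do rewrite big_set1; rewrite (@big_uniq_ord _ _ _ n F _ uF Fn).
Qed.

(** Only the class [- s] is removed, and singletons suffice as index sets: they give [L >= 4 / eps],
    so the main term [x.+1 / L] is at most [eps / 2 * x]. *)
Lemma shift_sievable_nat (R : realType) : shift_sievable R (fun=> True).
Proof.
move=> s eps s0 e0; exists (4 / eps) => F uF pF Fs BF.
pose z := (\sum_(p <- F) p)%N.
have Fz p : p \in F -> (p <= z)%N by move=> pF'; rewrite /z (big_rem p) //= leq_addr.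
pose LL := [set [set i : 'I_z.+1] | i in [set i : 'I_z.+1 | val i \in F]].
pose L : R := \sum_(A in LL) \prod_(i in A) (1%:R / (i%:R - 1%:R)).
have LE : L = \sum_(p <- F) (1 / (p%:R - 1)).
  by rewrite /L (@sum_singletons _ _ F (fun p => 1 / (p%:R - 1))) // => p /Fz.
have LB : 4 / eps <= L.
  rewrite LE (le_trans BF) // !big_seq; apply: ler_sum => p /(allP pF)/prime_gt1 p1.
  have p1R : 1 < p%:R :> R by rewrite ltr1n.
  by rewrite div1r lef_pV2 ?posrE; lra.
have L0 : 0 < L by apply: lt_le_trans LB; rewrite divr_gt0.
pose C := 2 * z%:R ^+ 4 / L ^+ 2.
have C0 : 0 <= C by rewrite /C !mulr_ge0 ?invr_ge0 ?exprn_ge0 // ltW.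
(* From here on the constant error [C] is below [eps / 2 * x]. *)
exists (Num.bound (2 * (C + 1) / eps)).+1 => x xx.
have xC : 2 * (C + 1) / eps < x%:R.
  apply: lt_le_trans (archi_boundP _) _; first by rewrite !mulr_ge0 ?invr_ge0 // ?addr_ge0 // ltW.
  by rewrite ler_nat ltnW.
rewrite count_upto_true.
set E := fun q : nat => _.
have sieve := @large_sieve R z.+1 LL (fun p m => (p%:Z %| m%:Z + s)%Z) (fun=> 1%N) z x.+1
  (fun m => `[< E m >]) L _ _ _ _ _ _ erefl.
have {}sieve : (count_upto E x)%:R * L ^+ 2 <= x.+1%:R * L + 2 * z%:R ^+ 4.
  apply: le_trans (sieve _ _ _ _ _ _).
  - by rewrite ler_wpM2r ?exprn_ge0 ?(ltW L0) // ler_nat count_upto_le_sum.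
  - by move=> A i /imsetP[j]; rewrite inE => jF ->; rewrite inE => /eqP ->; apply: (allP pF).
  - by move=> p m _; apply: dvdz_shift_periodic.
  - by move=> p; apply: count_residue.
  - by move=> p /prime_gt1; rewrite muln1.
  - by move=> A /imsetP[j]; rewrite inE => jF ->; rewrite big_set1 Fz.
  - move=> m A i _ /asboolP[_ Em] /imsetP[j]; rewrite inE => jF ->; rewrite inE => /eqP ->.
    by apply/negP/Em.
have {sieve} : (count_upto E x)%:R <= x.+1%:R / L + C.
  rewrite -(ler_pM2r (exprn_gt0 2 L0)) (le_trans sieve) // /C mulrDl le_eqVlt.
  by apply/orP; left; apply/eqP; field; rewrite gt_eqF.
move/le_trans; apply.
have x1 : 1 <= x%:R :> R by rewrite ler1n (leq_trans _ xx).
have : x.+1%:R / L <= (2 * x%:R) * (eps / 4).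
  apply: ler_pM => //; first by rewrite invr_ge0 ltW.
    by rewrite -natr1; lra.
  by rewrite -[eps / 4]invrK invf_div lef_pV2 ?posrE ?divr_gt0.
have : 2 * (C + 1) < x%:R * eps by rewrite -ltr_pdivrMr.
lra.
Qed.

Lemma ler_sum_prod1D (R : realFieldType) (F : seq nat) (g : nat -> R) :
  (forall p, 0 <= g p) -> 1 + \sum_(p <- F) g p <= \prod_(p <- F) (1 + g p).
Proof.
move=> g0; elim: F => [|p F IHF]; first by rewrite !big_nil addr0.
rewrite !big_cons.
have S0 : 0 <= \sum_(q <- F) g q by apply: sumr_ge0.
have h1 : 0 <= 1 + g p by rewrite addr_ge0.
apply: le_trans (ler_wpM2l h1 IHF).
have := mulr_ge0 (g0 p) S0; lra.
Qed.

(** Two removed classes are worth two Euler factors: one will complete the harmonic sum, the other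
    will supply the extra gain [B]. *)
Lemma two_residue_weight_ge (R : realFieldType) (p : nat) : (4 < p)%N ->
  (1 + p%:R^-1) * (1 + p%:R^-1) <= 1 + 2%:R / (p%:R - 2%:R) :> R.
Proof.
move=> p4; have : 4 < p%:R :> R by rewrite ltr_nat.
move: (p%:R : R) => x x4.
rewrite -subr_ge0.
have -> : 1 + 2 / (x - 2) - (1 + x^-1) * (1 + x^-1) = (3 * x + 2) / (x ^+ 2 * (x - 2)).
  by field; rewrite !gt_eqF //; lra.
by rewrite divr_ge0 ?mulr_ge0 ?sqr_ge0 //; lra.
Qed.

(* The primes of F occupy two residue classes (0 and -s), so their weights exceed
   the weights 1/p of the harmonic sum by a factor at least 1 + 1/p. *)
Lemma sieve_weight_ge (R : realFieldType) (n j : nat) (F : seq nat) (w : nat -> nat)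
    (Q : pred {set 'I_n}) (B : R) :
  uniq F -> all prime F -> (forall p, p \in F -> (4 < p < n)%N) -> (2 ^ j < n)%N ->
  (forall A, Q A = [forall (i | i \in A), prime i] && (\prod_(i in A) i <= 2 ^ j)%N) ->
  (forall p, w p = if p \in F then 2 else 1)%N ->
  0 <= B -> B <= \sum_(p <- F) p%:R^-1 ->
  B * (j%:R / 4) <= \sum_(A in [set A | Q (A :\: [set i : 'I_n | val i \in F])])
    \prod_(i in A) ((w i)%:R / (i%:R - (w i)%:R)).
Proof.
move=> uF pF Fn jn QE wE B0 BF; set FS := [set i : 'I_n | val i \in F].
have Flt p : p \in F -> (p < n)%N by move/Fn => /andP[].
under eq_bigl do rewrite inE.
rewrite sum_prod_split; set T' := \sum_(A : {set 'I_n} | _) _.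
pose T : R := \sum_(A : {set 'I_n} | [disjoint A & FS] && Q A) \prod_(i in A) (i%:R^-1).
have TT' : T <= T'.
  apply: ler_sum => A /andP[dA]; rewrite QE => /andP[/forall_inP pA _].
  apply: ler_prod => i iA; rewrite invr_ge0 ler0n /= wE.
  have -> : (val i \in F) = false.
    by apply/negP => iF; have := disjointFr dA iA; rewrite inE iF.
  have i1 : 1 < i%:R :> R by rewrite ltr1n prime_gt1 ?pA.
  by rewrite div1r lef_pV2 ?posrE; lra.
have T0 : 0 <= T by apply: sumr_ge0 => A _; apply: prodr_ge0 => i _; rewrite invr_ge0.
pose P : R := \prod_(p <- F) (1 + p%:R^-1).
have BP : B <= P.
  apply: le_trans BF (le_trans _ (@ler_sum_prod1D R F (fun p => p%:R^-1) _)); first by rewrite lerDr.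
  by move=> p; rewrite invr_ge0.
(* One product [P] restores the primes of [F] to [T], and the result covers all squarefree numbers
   up to [2 ^ j]. The second [P], available by [PP], is at least [B]. *)
have harm : j%:R / 2 <= 2 * (P * T).
  apply: le_trans (sum_harmonic_exp2 R j) _.
  rewrite /P (@big_uniq_ord _ _ _ n F _ uF Flt) -/FS -sum_prod_split.
  have := @sum_inv_le_sum_squarefree R n (2 ^ j) [set A | Q (A :\: FS)] jn.
  under [X in _ -> _ -> _ <= _ * X]eq_bigl do rewrite inE.
  apply.
    move=> A; rewrite inE QE => /andP[/forall_inP pA _] i iA.
    have [iF|iF] := boolP (i \in FS); first by move: iF; rewrite inE => /(allP pF).
    by apply: pA; rewrite inE iF.
  move=> A pA leA; rewrite inE QE; apply/andP; split.
    by apply/forall_inP => i; rewrite inE => /andP[_ /pA].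
  apply: leq_trans leA; rewrite [leqRHS](big_setID FS) /= leq_pmull //.
  by apply: prodn_cond_gt0 => i; rewrite inE => /andP[/pA/prime_gt0].
have PP : P * P <= \prod_(i in FS) (1 + (w i)%:R / (i%:R - (w i)%:R)).
  rewrite /P (@big_uniq_ord _ _ _ n F _ uF Flt) -/FS -big_split /=.
  apply: ler_prod => i; rewrite inE => iF.
  rewrite wE iF two_residue_weight_ge; last by have /andP[] := Fn _ iF.
  by rewrite mulr_ge0 // addr_ge0 ?invr_ge0.
have P0 : 0 <= P := le_trans B0 BP.
apply: (@le_trans _ _ (P * P * T)).
  rewrite -mulrA; apply: ler_pM => //; first by rewrite divr_ge0.
  by move: harm; lra.
by apply: ler_pM => //; rewrite mulr_ge0.
Qed.

(** A prime [q >= n] avoids the class 0 modulo every prime below [n], and here also [- s] modulo the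
    primes of [F]. The first saves a factor [j / 4], the second a factor [B]; the term [z + z]
    accounts for [q < n]. *)
Lemma sieve_primes (R : realFieldType) (F : seq nat) (s : int) (B : R) (j x z : nat) :
  uniq F -> all prime F -> (forall p, p \in F -> (4 < p)%N /\ ~ (p%:Z %| s)%Z) ->
  1 <= B -> B <= \sum_(p <- F) p%:R^-1 -> (4 <= j)%N ->
  z = (2 ^ j * \prod_(p <- F) p)%N ->
  (count_upto (fun q : nat => prime q /\ forall p, p \in F -> ~ (p%:Z %| q%:Z + s)%Z) x)%:R
    <= x.+1%:R / (B * (j%:R / 4)) + 2 * z%:R ^+ 4 + (z + z)%N%:R :> R.
Proof.
move=> uF pF Fs B1 BF j4; pose E q := prime q /\ forall p, p \in F -> ~ (p%:Z %| q%:Z + s)%Z.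
rewrite -/E; set PF := (\prod_(p <- F) p)%N => zE.
have PF0 : (0 < PF)%N.
  by rewrite /PF big_seq; apply: prodn_cond_gt0 => p /(allP pF)/prime_gt0.
have FPF p : p \in F -> (p <= PF)%N.
  move=> pF'; apply: dvdn_leq => //; by rewrite /PF (big_rem p) //= dvdn_mulr.
have tj : (0 < 2 ^ j)%N by rewrite expn_gt0.
pose n := (2 ^ j + PF).+1.
have Fn p : p \in F -> (4 < p < n)%N.
  by move=> pF'; have [-> _] := Fs _ pF'; rewrite /n ltnS (leq_trans (FPF _ pF')) ?leq_addl.
have jn : (2 ^ j < n)%N by rewrite /n ltnS leq_addr.
have Flt p : p \in F -> (p < n)%N by move/Fn => /andP[].
pose FS := [set i : 'I_n | val i \in F].
pose Q (A : {set 'I_n}) := [forall (i | i \in A), prime i] && (\prod_(i in A) i <= 2 ^ j)%N.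
(* Only the part of [A] outside [F] is limited to [2 ^ j]; the part inside divides [PF], whence the
   level [z]. *)
pose LL := [set A | Q (A :\: FS)].
pose w p := if p \in F then 2%N else 1%N.
pose Om p m := (p %| m)%N || ((p \in F) && (p%:Z %| m%:Z + s)%Z).
pose L : R := \sum_(A in LL) \prod_(i in A) ((w i)%:R / (i%:R - (w i)%:R)).
have LB : B * (j%:R / 4) <= L.
  by apply: (@sieve_weight_ge R n j F w Q B) => //; apply: le_trans B1.
have j4R : 4 <= j%:R :> R by rewrite ler_nat.
have D1 : 1 <= B * (j%:R / 4).
  by apply: mulr_ege1 => //; lra.
have L1 : 1 <= L by apply: le_trans LB.
have L0 : 0 < L by apply: lt_le_trans L1.
have pLL A i : A \in LL -> i \in A -> prime i.
  rewrite inE => /andP[/forall_inP pA _] iA.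
  have [iF|iF] := boolP (i \in FS); first by move: iF; rewrite inE => /(allP pF).
  by apply: pA; rewrite inE iF.
have disj p m : p \in F -> (p %| m)%N -> (p%:Z %| m%:Z + s)%Z = false.
  move=> pF' pm; apply/negP => pms; have [_] := Fs _ pF'; apply.
  by move: pms; rewrite rpredDl.
have sieve := @large_sieve R n LL Om w z x.+1
  (fun m => `[< (n <= m)%N /\ E m >]) L _ _ _ _ _ _ erefl.
set E' := fun m => (n <= m)%N /\ E m in sieve.
have {}sieve : (count_upto E' x)%:R * L ^+ 2 <= x.+1%:R * L + 2 * z%:R ^+ 4.
  apply: le_trans (sieve _ _ _ _ _ _).
  - by rewrite ler_wpM2r ?exprn_ge0 ?(ltW L0) // ler_nat count_upto_le_sum.
  - exact: pLL.
  - by move=> p m _; rewrite /Om dvdn_addl // dvdz_shift_periodic.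
  - move=> p pp.
    rewrite (eq_bigr (fun m : 'I_p => (p%:Z %| (m%:Z + 0)%R)%Z +
      (if p \in F then (p%:Z %| (m%:Z + s)%R)%Z : nat else 0))%N); last first.
      move=> m _; rewrite /Om addr0 (_ : (p%:Z %| m%:Z)%Z = (p %| m)%N); last by rewrite dvdzE.
      case: (boolP (p \in F)) => [pF'|_]; last by rewrite orbF addn0.
      by case: (boolP (p %| m)%N) => [/(disj _ _ pF') ->|_].
    rewrite big_split /= count_residue // /w; case: ifP => _; last by rewrite big1.
    by rewrite count_residue.
  - move=> p /prime_gt1 p1; rewrite /w; case: ifP => [pF'|_]; last by rewrite muln1.
    by have [/ltnW] := Fs _ pF'.
  - move=> A AL; rewrite zE (big_setID FS) /= mulnC leq_mul //.
      by move: AL; rewrite inE => /andP[].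
    rewrite /PF (@big_uniq_ord _ _ _ n F _ uF Flt) -/FS.
    rewrite [leqRHS](big_setID A) /= finset.setIC leq_pmulr //.
    apply: prodn_cond_gt0 => i; rewrite !inE => /andP[_ /(allP pF)]; exact: prime_gt0.
  - move=> m A i _ /asboolP[nm [pm Em]] AL iA.
    have pi := pLL _ _ AL iA.
    rewrite /Om negb_or; apply/andP; split.
      rewrite dvdn_prime2 //; apply/eqP => im.
      by have := leq_trans (ltn_ord i) nm; rewrite im ltnn.
    by apply/negP => /andP[iF]; apply: Em.
have {sieve} : (count_upto E' x)%:R <= x.+1%:R / L + 2 * z%:R ^+ 4.
  rewrite -(ler_pM2r (exprn_gt0 2 L0)) (le_trans sieve) // [leRHS]mulrDl; apply: lerD.
    by rewrite expr2 mulrA divfK ?gt_eqF.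
  by rewrite ler_peMr ?mulr_ge0 ?exprn_ge0 // exprn_ege1.
have xL : x.+1%:R / L <= x.+1%:R / (B * (j%:R / 4)).
  by rewrite ler_wpM2l // lef_pV2 ?posrE //; apply: lt_le_trans D1.
have cE : (count_upto E x <= n + count_upto E' x)%N.
  apply: leq_trans (leq_add (count_upto_lt n x) (leqnn _)).
  apply: leq_trans (count_upto_or _ _ _); apply: count_upto_le => q Eq.
  by case: (ltnP q n) => H; [left|right].
have nz : (n <= z + z)%N.
  rewrite /n zE.
  have : (2 ^ 4 <= 2 ^ j)%N by rewrite leq_exp2l.
  by move: PF0; generalize (2 ^ j)%N PF => a b; rewrite -[(2 ^ 4)%N]/16%N; clear; nia.
have : (count_upto E x)%:R <= (z + z)%N%:R + (count_upto E' x)%:R :> R.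
  by rewrite -natrD ler_nat (leq_trans cE) // leq_add2r.
lra.
Qed.

(** With [2 ^ j] about the eighth root of [x], the error [z ^ 4] has order at most the square root
    of [x], while Chebyshev's bound turns the main term into a multiple of [primepi x / B]. *)
Lemma shift_sievable_prime (R : realType) : shift_sievable R (fun q => prime q).
Proof.
(* By [x + 1 <= 2 x] and [x <= 48 * j * primepi x] the main term is at most [384 * primepi x / B];
   half of [eps] is allotted to it. *)
move=> s eps s0 e0; pose B : R := 768 / eps + 1.
have e768 : 0 < 768 / eps by rewrite divr_gt0.
exists B => F uF pF Fs BF.
have B1 : 1 <= B by rewrite /B; lra.
pose PF : R := (\prod_(p <- F) p)%N%:R.
have PF0 : 0 <= PF by rewrite ler0n.
pose C := 2 * PF ^+ 4 + 2 * PF.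
have C0 : 0 <= C by rewrite addr_ge0 ?mulr_ge0 ?exprn_ge0.
pose j0 := (Num.bound (96 * C / eps) + 4)%N.
exists (2 ^ (8 * j0))%N => x xx.
have x0 : (0 < x)%N by apply: leq_trans xx; rewrite expn_gt0.
pose j := (trunc_log 2 x %/ 8)%N.
have j0j : (j0 <= j)%N by rewrite /j leq_divRL // mulnC trunc_log_max.
have j4 : (4 <= j)%N by apply: leq_trans j0j; rewrite leq_addl.
have jx : (2 ^ (8 * j) <= x)%N.
  by rewrite (leq_trans _ (trunc_logP (isT : 1 < 2)%N x0)) // leq_exp2l // mulnC leq_trunc_div.
(* The binary logarithm of [x] is below [8 j + 8 <= 16 j]; with the 3 of [chebyshev_lower] this
   makes the 48 of [cheb]. *)
have xj : (x < 2 ^ (16 * j))%N.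
  apply: leq_trans (trunc_log_ltn x (isT : 1 < 2)%N) _; rewrite leq_exp2l //.
  have := divn_eq (trunc_log 2 x) 8; have := @ltn_pmod (trunc_log 2 x) 8 isT.
  rewrite -/j; lia.
have x2 : (2 <= x)%N.
  by rewrite (leq_trans _ jx) // -{1}(expn1 2) leq_exp2l //; lia.
have cheb : x%:R <= 48 * j%:R * (primepi x)%:R :> R.
  by rewrite -!natrM ler_nat; have := chebyshev_lower x2 xj; rewrite mulnA.
apply: le_trans (@sieve_primes R F s B j x _ uF pF Fs B1 BF j4 erefl) _.
rewrite count_upto_prime natrD natrM natrX -/PF.
set T : R := 2%:R ^+ j.
have T1 : 1 <= T by rewrite exprn_ege1 // ler1n.
have TX : T ^+ 8 <= x%:R by rewrite /T -exprM mulnC -natrX ler_nat.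
have jT : j%:R <= T by rewrite /T -natrX ler_nat ltnW // ltn_expl.
have jR : 4 <= j%:R :> R by rewrite ler_nat.
have Cj : 96 * C / eps <= j%:R.
  apply: ltW; apply: lt_le_trans (archi_boundP _) _; first by rewrite divr_ge0 ?mulr_ge0 // ltW.
  by rewrite ler_nat (leq_trans _ j0j) // leq_addr.
have x1R : 1 <= x%:R :> R by rewrite ler1n.
rewrite -natr1; move: (x%:R : R) (j%:R : R) ((primepi x)%:R : R) T1 TX jT jR Cj cheb x1R.
move: T => T X J p T1 TX JT J4 CJ cheb X1.
have J0 : 0 < J by apply: lt_le_trans J4.
have B0 : 0 < B by apply: lt_le_trans B1.
have T0 : 0 <= T by apply: le_trans T1.
have p0 : 0 <= p.
  have J48 : 0 < 48 * J by lra.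
  by rewrite -(pmulr_rge0 p J48); lra.
have first_part : (X + 1) / (B * (J / 4)) <= eps / 2 * p.
  rewrite ler_pdivrMr ?mulr_gt0 ?invr_gt0 //.
  have eB : 768 <= eps * B by rewrite mulrC -ler_pdivrMr // /B; lra.
  have : 768 * (J * p) <= eps * B * (J * p) by rewrite ler_wpM2r // mulr_ge0 // ltW.
  lra.
have second_part : 2 * (T * PF) ^+ 4 + (T * PF + T * PF) <= C * T ^+ 4.
  have T4 : T <= T ^+ 4 by rewrite -{1}(expr1 T) ler_weXn2l.
  have := ler_wpM2r PF0 T4; rewrite /C exprMn; lra.
(* Combines [J ^ 2 <= T ^ 4], [T ^ 8 <= X] and [96 * C <= J * eps], where 96 is twice the Chebyshev
   constant. *)
have third_part : C * T ^+ 4 <= eps / 2 * p.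
  have JJ : J * J <= T ^+ 4.
    apply: (@le_trans _ _ (T ^+ 2)); last by rewrite ler_weXn2l.
    by rewrite expr2; apply: ler_pM => //; apply: ltW.
  have c1 : 96 * C <= J * eps by rewrite -ler_pdivrMr.
  have c2 : 96 * C * J <= eps * T ^+ 4.
    apply: le_trans (ler_wpM2r (ltW J0) c1) _.
    by rewrite mulrAC mulrC ler_pM2l.
  have c3 : 96 * C * J * T ^+ 4 <= eps * (48 * J * p).
    apply: le_trans (ler_wpM2r (exprn_ge0 4 T0) c2) _.
    rewrite -[leLHS]mulrA -exprD; apply: le_trans (ler_wpM2l (ltW e0) TX) _.
    by rewrite ler_pM2l.
  have J96 : 0 < 96 * J by lra.
  rewrite -(ler_pM2l J96); lra.
lra.
Qed.

(** * Divisors in a prescribed residue class *)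

Definition inv_prime_sum (R : realType) (Q : pred nat) (m n : nat) : R :=
  \sum_(m <= p < n | prime p && Q p) p%:R^-1.

Definition prime_rich (R : realType) (M c : nat) : Prop :=
  forall B : R, exists y, B <= inv_prime_sum R (fun p => p == c %[mod M]) 0 y.

Lemma inv_prime_sum_ge0 (R : realType) (Q : pred nat) (m n : nat) :
  0 <= inv_prime_sum R Q m n.
Proof. by apply: sumr_ge0 => p _; rewrite invr_ge0. Qed.

(** If every tail exceeded [d] somewhere, consecutive blocks of sum more than [d] would push the
    partial sums beyond [B]. *)
Lemma inv_prime_sum_tail (R : realType) (Q : pred nat) (B : R) :
  (forall y, inv_prime_sum R Q 0 y <= B) ->
  forall d : R, 0 < d -> exists Y, forall y, inv_prime_sum R Q Y y <= d.
Proof.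
move=> bB d d0; apply: contrapT => /forallNP nY.
have step k : exists y, d * k%:R <= inv_prime_sum R Q 0 y.
  elim: k => [|k [y IHy]]; first by exists 0%N; rewrite mulr0 inv_prime_sum_ge0.
  have /existsNP[y' /negP] := nY y; rewrite -ltNge => lt.
  have yy' : (y <= y')%N.
    rewrite leqNgt; apply/negP => /ltnW le; move: lt.
    by rewrite /inv_prime_sum big_geq // ltNge (ltW d0).
  exists y'; rewrite /inv_prime_sum (big_cat_nat (n := y)) //= -natr1 mulrDr mulr1.
  by apply: lerD => //; exact: ltW.
have B0 : 0 <= B := le_trans (inv_prime_sum_ge0 R Q 0 0) (bB 0%N).
have [y] := step (Num.bound (B / d)); rewrite leNgt => /negP[].
rewrite (le_lt_trans (bB y)) // mulrC -ltr_pdivrMr //.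
by rewrite archi_boundP // divr_ge0 // ltW.
Qed.

(** A prime below [Z] counts for at most [Z] times its reciprocal. Hence primes with convergent
    reciprocal sum have density zero, which controls the rounding errors of [count_multiples_le]. *)
Lemma count_primes_le (R : realType) (Q : pred nat) (Y Z : nat) :
  (\sum_(0 <= p < Z | prime p && Q p) 1)%N%:R <= Y%:R + Z%:R * inv_prime_sum R Q Y Z.
Proof.
have tail m : \sum_(m <= p < Z | prime p && Q p) 1 <= Z%:R * inv_prime_sum R Q m Z.
  rewrite mulr_sumr big_nat_cond [leRHS]big_nat_cond; apply: ler_sum => p /andP[/andP[_ pZ] /andP[pp _]].
  by rewrite ler_pdivlMr ?ltr0n ?prime_gt0 // mul1r ler_nat ltnW.
rewrite natr_sum; have [YZ|ZY] := leqP Y Z; last first.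
  apply: (@le_trans _ _ Y%:R); last by rewrite lerDl mulr_ge0 ?inv_prime_sum_ge0.
  apply: (@le_trans _ _ (\sum_(0 <= p < Z) 1)).
    by rewrite big_mkcond; apply: ler_sum => p _; case: ifP.
  by rewrite sumr_const_nat subn0 ler_nat ltnW.
rewrite (big_cat_nat (n := Y)) //=; apply: lerD; last exact: tail.
apply: (@le_trans _ _ (\sum_(0 <= p < Y) 1)).
  by rewrite big_mkcond; apply: ler_sum => p _; case: ifP.
by rewrite sumr_const_nat subn0.
Qed.

(** As [m] is invertible modulo [p], each block of [p] consecutive [k] contains at most one
    solution; the range is enlarged to whole blocks. *)
Lemma count_multiples_le (R : realFieldType) (p a m X : nat) : prime p -> coprime p m ->
  \sum_(k < X) (p %| a + k * m)%N%:R <= X%:R / p%:R + 1 :> R.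
Proof.
move=> pp com; have p0 := prime_gt0 pp.
have per k : (p %| a + (k + p) * m)%N%:R = (p %| a + k * m)%N%:R :> R.
  by rewrite mulnDl addnA dvdn_addl // dvdn_mulr.
have one : \sum_(k < p) (p %| a + k * m)%N%:R <= 1 :> R.
  have [/existsP[k0 H0]|/existsPn H] := boolP [exists k : 'I_p, (p %| a + k * m)%N]; last first.
    by rewrite big1 // => k _; rewrite (negbTE (H k)).
  rewrite (bigD1 k0) //= H0 big1 ?addr0 // => k kk0.
  case: (boolP (p %| _)%N) => // H1; case/negP: kk0; apply/eqP/val_inj => /=.
  wlog le : k k0 H0 H1 / (k <= k0)%N => [wl|].
    by have [le|/ltnW le] := leqP k k0; [exact: wl|symmetry; exact: wl].
  have : (p %| (k0 - k) * m)%N.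
    rewrite mulnBl -(subnDl a) dvdn_sub //.
  rewrite Gauss_dvdl // => /dvdnP[[|l] e]; first by lia.
  have := ltn_ord k0; nia.
have Xle : (X <= (X %/ p).+1 * p)%N by rewrite ltnW // -ltn_divLR.
apply: (@le_trans _ _ (\sum_(k < (X %/ p).+1 * p) (p %| a + k * m)%N%:R)).
  rewrite -(subnKC Xle) big_split_ord /= lerDl; exact: sumr_ge0.
rewrite (sum_periodic _ per) -[leLHS]mulr_natl.
apply: (@le_trans _ _ ((X %/ p).+1%:R * 1)); first exact: ler_wpM2l.
rewrite mulr1 -natr1 lerD2r ler_pdivlMr ?ltr0n // -natrM ler_nat; exact: leq_trunc_div.
Qed.

Definition rich_product (R : realType) (M t : nat) : Prop :=
  exists2 cs : seq nat, (forall c, c \in cs -> prime_rich R M c) &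
    \prod_(c <- cs) c = t %[mod M].

Lemma rich_product1 (R : realType) (M : nat) : rich_product R M 1.
Proof. by exists [::]; rewrite ?big_nil. Qed.

Lemma rich_productM (R : realType) (M s t : nat) :
  rich_product R M s -> rich_product R M t -> rich_product R M (s * t).
Proof.
move=> [cs Hcs es] [ct Hct et]; exists (cs ++ ct).
  by move=> c; rewrite mem_cat => /orP[/Hcs|/Hct].
by rewrite big_cat /= -modnMm es et modnMm.
Qed.

Lemma rich_product_primes (R : realType) (M n : nat) : (0 < n)%N ->
  (forall p, prime p -> (p %| n)%N -> rich_product R M p) -> rich_product R M n.
Proof.
move=> n0 Kp; rewrite (prod_prime_decomp n0) big_seq.
elim/big_ind: _ => [||[p e] /mem_prime_decomp[pp e0 dv] /=].
- exact: rich_product1.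
- exact: rich_productM.
have {}Kp : rich_product R M p by apply: Kp => //; apply: dvdn_trans dv; rewrite dvdn_exp.
elim: e {e0 dv} => [|e IHe]; first exact: rich_product1.
by rewrite expnS; apply: rich_productM.
Qed.

(** A prime that is not a rich product lies in a class that is not rich, and there are finitely many
    classes, each with bounded sum. *)
Lemma not_rich_sum_bounded (R : realType) (M : nat) : (0 < M)%N ->
  exists B, forall y, inv_prime_sum R (fun p => `[< ~ rich_product R M p >]) 0 y <= B.
Proof.
move=> M0.
have /choice[B HB] (c : nat) : exists B : R, 0 <= B /\ (~ prime_rich R M c ->
    forall y, inv_prime_sum R (fun p => p == c %[mod M]) 0 y <= B).
  have [cr|/existsNP[B nB]] := pselect (prime_rich R M c); first by exists 0.
  have le y : inv_prime_sum R (fun p => p == c %[mod M]) 0 y <= B.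
    by rewrite leNgt; apply/negP => /ltW lt; apply: nB; exists y.
  by exists B; split => // ; apply: le_trans (le 0%N); exact: inv_prime_sum_ge0.
exists (\sum_(c < M) B c) => y; rewrite /inv_prime_sum.
rewrite (partition_big (fun p => Ordinal (ltn_pmod p M0)) xpredT) //=.
apply: ler_sum => c _; have [B0 Bc] := HB c.
have [cr|ncr] := pselect (prime_rich R M c).
  rewrite big_pred0 // => p; apply/negP => /andP[/andP[_ /asboolP nK] /eqP/(congr1 val) /= pc].
  apply: nK; exists [:: nat_of_ord c]; first by move=> d; rewrite inE => /eqP->.
  by rewrite big_seq1 -pc modn_mod.
apply: le_trans (Bc ncr y); rewrite /inv_prime_sum big_mkcond [leRHS]big_mkcond /=.
apply: ler_sum => p _; case: ifP => [/andP[/andP[-> _] /eqP/(congr1 val) /= pc]|_].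
  by rewrite -pc modn_mod eqxx.
by case: ifP => _; rewrite ?invr_ge0.
Qed.

(* Otherwise the primes outside the submonoid of rich products would have a
   convergent reciprocal sum, so that a positive proportion of the integers
   congruent to b would avoid them all and hence be rich products. *)
Lemma coprime_rich_product (R : realType) (M b : nat) :
  (0 < M)%N -> coprime b M -> rich_product R M b.
Proof.
move=> M0 cob; apply: contrapT => nKb.
have [B0 HB0] := not_rich_sum_bounded R M0.
pose Q p := `[< ~ rich_product R M p >] && coprime p M.
have HB y : inv_prime_sum R Q 0 y <= B0.
  apply: le_trans (HB0 y); rewrite /inv_prime_sum big_mkcond [leRHS]big_mkcond /=.
  apply: ler_sum => p _; rewrite /Q; case: ifP => [/andP[-> /andP[-> _]] //|_].
  by case: ifP => _; rewrite ?invr_ge0.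
have d4 : 0 < 4^-1 :> R by rewrite invr_gt0.
have [Y HY] := inv_prime_sum_tail HB d4.
(* Imposing the class 1 modulo [W] excludes the primes of [Q] below [Y]. *)
pose W := (\prod_(0 <= p < Y | prime p && Q p) p)%N.
have W0 : (0 < W)%N by apply: prodn_cond_gt0 => p /andP[/prime_gt0].
have coMW : coprime M W.
  rewrite /W coprime_sym; elim/big_ind: _ => [|x y cx cy|p /andP[_ /andP[_ //]]].
    exact: coprime1n.
  by rewrite coprimeMl cx cy.
have pW p : prime p -> Q p -> (p < Y)%N -> (p %| W)%N.
  by move=> pp Qp pY; rewrite /W (big_rem p) ?mem_index_iota //= pp Qp dvdn_mulr.
pose m := (M * W)%N; have m0 : (0 < m)%N by rewrite muln_gt0 M0.
have m0R : 0 < m%:R :> R by rewrite ltr0n.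
have com p : prime p -> Q p -> (Y <= p)%N -> coprime p m.
  move=> pp /andP[_ pM] Yp; rewrite coprimeMr pM prime_coprime //=.
  rewrite -prime_coprime // /W big_nat_cond.
  elim/big_ind: _ => [|x y cx cy|p' /andP[/andP[_ p'Y] /andP[pp' _]]].
  - exact: coprimen1.
  - by rewrite coprimeMr cx cy.
  - rewrite prime_coprime // dvdn_prime2 //; apply/eqP => e.
    by move: p'Y; rewrite -e ltnNge Yp.
have d8 : 0 < (8 * m%:R)^-1 :> R by rewrite invr_gt0 mulr_gt0.
have [Y' HY'] := inv_prime_sum_tail HB d8.
pose a := chinese M W b 1; pose X := (4 * (Y' + a + m + 2))%N.
pose Z := (a + m + X * m).+1.
pose n k := (a + m + k * m)%N.
have nZ k : (k < X)%N -> (n k < Z)%N by move=> kX; rewrite /n /Z ltnS leq_add2l leq_mul2r ltnW ?orbT.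
have nM k : n k = b %[mod M].
  by rewrite /n -addnA -mulSn mulnA -modnDmr mulnAC modnMl addn0 /a chinese_modl.
have nW k : n k = 1 %[mod W].
  by rewrite /n -addnA -mulSn mulnA -modnDmr modnMl addn0 /a chinese_modr.
have hit k : (k < X)%N -> exists p, [/\ prime p, Q p, (Y <= p < Z)%N & (p %| n k)%N].
  move=> kX; apply: contrapT => nohit; apply: nKb.
  have [cs Hcs e] : rich_product R M (n k); last by exists cs => //; rewrite e.
  have nk0 : (0 < n k)%N by rewrite /n; lia.
  apply: rich_product_primes => // p pp pn.
  apply: contrapT => nKp; apply: nohit; exists p.
  have Qp : Q p.
    apply/andP; split; first exact/asboolP.
    by apply: coprime_dvdl pn _; rewrite -coprime_modl nM coprime_modl.
  split => //; apply/andP; split; last by rewrite (leq_ltn_trans _ (nZ k kX)) // dvdn_leq.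
  rewrite leqNgt; apply/negP => /(pW _ pp Qp) dW.
  have : (p %| 1)%N.
    have := nW k => /eqP; rewrite eqn_mod_dvd // => /(dvdn_trans dW) d1.
    by rewrite -(dvdn_subr (_ : 1 <= n k)%N pn).
  by rewrite dvdn1 => /eqP p1; rewrite p1 in pp.
have XR : X%:R <= \sum_(Y <= p < Z | prime p && Q p) \sum_(k < X) (p %| n k)%N%:R :> R.
  rewrite exchange_big /= -[in leLHS](card_ord X) -sum1_card natr_sum.
  apply: ler_sum => k _; have [p [pp Qp pZ pn]] := hit k (ltn_ord k).
  by rewrite (big_rem p) ?mem_index_iota //= pp Qp pn lerDl sumr_ge0.
have XR2 : X%:R <= X%:R * inv_prime_sum R Q Y Z + (\sum_(0 <= p < Z | prime p && Q p) 1)%N%:R.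
  apply: le_trans XR _.
  apply: (@le_trans _ _ (\sum_(Y <= p < Z | prime p && Q p) (X%:R / p%:R + 1))).
    rewrite big_nat_cond [leRHS]big_nat_cond.
    apply: ler_sum => p /andP[/andP[Yp _] /andP[pp Qp]].
    by apply: count_multiples_le => //; apply: com.
  rewrite big_split /= mulr_sumr natr_sum; apply: lerD => //.
  have [YZ|ZY] := leqP Y Z; last by rewrite big_geq ?sumr_ge0 // ltnW.
  by rewrite [leRHS](big_cat_nat (n := Y)) //= lerDr sumr_ge0.
have cnt := count_primes_le R Q Y' Z.
have h1 := ler_wpM2l (ler0n R X) (HY Z).
have h2 := ler_wpM2l (ler0n R Z) (HY' Z).
have ZE : Z%:R / (8 * m%:R) <= (a%:R + 2 + X%:R) / 8 :> R.
  rewrite ler_pdivrMr ?mulr_gt0 //.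
  have -> : (a%:R + 2 + X%:R) / 8 * (8 * m%:R) = ((a + 2 + X) * m)%N%:R :> R.
    by rewrite natrM !natrD; field.
  rewrite ler_nat /Z; nia.
have XE : X%:R = 4 * (Y'%:R + a%:R + m%:R + 2) :> R by rewrite /X natrM !natrD.
have a0 : 0 <= a%:R :> R by [].
have Y0 : 0 <= Y'%:R :> R by [].
lra.
Qed.

Lemma density_le_or (R : realType) (P E E1 E2 : nat -> Prop) (e1 e2 : R) :
  (forall q, P q -> E q -> E1 q \/ E2 q) ->
  density_le P E1 e1 -> density_le P E2 e2 -> density_le P E (e1 + e2).
Proof.
move=> EE [x1 H1] [x2 H2]; exists (maxn x1 x2) => x; rewrite geq_max => /andP[xx1 xx2].
rewrite mulrDl; apply: le_trans (lerD (H1 x xx1) (H2 x xx2)).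
rewrite -natrD ler_nat; apply: leq_trans (count_upto_or _ _ _).
by apply: count_upto_le => q [Pq Eq]; case: (EE q Pq Eq); tauto.
Qed.

Lemma rich_seq_density (R : realType) (P : nat -> Prop) (M : nat) (s : int) (cs : seq nat) :
  shift_sievable R P -> s != 0 -> (forall c, c \in cs -> prime_rich R M c) ->
  forall (Y : nat) (eps : R), 0 < eps -> density_le P
    (fun q => ~ exists f : nat, [/\ (f%:Z %| q%:Z + s)%Z, f = \prod_(c <- cs) c %[mod M] &
      forall p, prime p -> (p %| f)%N -> (Y <= p)%N]) eps.
Proof.
move=> sP s0; elim: cs => [|c cs IHcs] Hcs Y eps e0.
  exists 0%N => x _; rewrite [count_upto _ _](_ : _ = 0%N) ?mulr_ge0 ?(ltW e0) //.
  apply/eqP; rewrite -leqn0 (@leq_trans (count_upto (fun=> False) x)) //.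
    apply: count_upto_le => q [_]; apply; exists 1%N; rewrite big_nil dvd1z; split => //.
    by move=> p pp; rewrite dvdn1 => /eqP p1; rewrite p1 in pp.
  by rewrite /count_upto big_pred0 // => q; apply: asboolF.
have e2 : 0 < eps / 2 by rewrite divr_gt0.
have [B HB] := sP s (eps / 2) s0 e2.
pose Y0 := maxn (maxn Y 5) `|s|.+1.
have [y Hy] := Hcs c (mem_head _ _) (B + inv_prime_sum R (fun p => p == c %[mod M]) 0 Y0).
pose F := [seq p <- index_iota Y0 y | prime p && (p == c %[mod M])].
have FE p : p \in F -> [/\ prime p, p = c %[mod M] & (Y0 <= p)%N].
  by rewrite mem_filter mem_index_iota => /andP[/andP[pp /eqP pc] /andP[]].
have BF : B <= \sum_(p <- F) p%:R^-1.
  rewrite big_filter -/(inv_prime_sum R _ Y0 y).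
  have [Yy|/ltnW yY] := leqP Y0 y.
    have splitE : inv_prime_sum R (fun p => p == c %[mod M]) 0 y =
        inv_prime_sum R (fun p => p == c %[mod M]) 0 Y0 +
        inv_prime_sum R (fun p => p == c %[mod M]) Y0 y.
      by rewrite /inv_prime_sum (big_cat_nat (n := Y0)).
    by move: Hy; rewrite splitE addrC lerD2l.
  rewrite /inv_prime_sum big_geq // -(lerD2r (inv_prime_sum R (fun p => p == c %[mod M]) 0 Y0)) add0r.
  apply: le_trans Hy _; rewrite [leRHS](big_cat_nat (n := y)) //= lerDl.
  by apply: inv_prime_sum_ge0.
pose Y1 := (\sum_(p <- F) p).+1.
have FY1 p : p \in F -> (p < Y1)%N by move=> pF; rewrite /Y1 ltnS (big_rem p) //= leq_addr.
rewrite [eps]splitr; apply: (density_le_or _ (HB F _ _ _ BF) (IHcs _ Y1 _ e2)).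
- move=> q Pq nf; have [H|/existsNP[p /not_implyP[pF /contrapT pq]]] :=
    pselect (forall p, p \in F -> ~ (p%:Z %| q%:Z + s)%Z); first by left.
  right => -[f [fq ef Yf]]; apply: nf; exists (p * f)%N.
  have [pp pc Yp] := FE p pF.
  have npf : ~~ (p %| f)%N by apply/negP => /(Yf p pp); rewrite leqNgt FY1.
  split.
  + rewrite PoszM Gauss_dvdz ?pq ?fq //.
    by rewrite coprimezE /= prime_coprime.
  + by rewrite big_cons -modnMm pc ef modnMm.
  + move=> r pr; rewrite Euclid_dvdM // => /orP[|/(Yf r pr)].
      rewrite dvdn_prime2 // => /eqP->; apply: leq_trans Yp.
      by rewrite /Y0 -maxnA leq_maxl.
    move=> Yr; apply: leq_trans Yr; apply: leq_trans (ltnW (FY1 _ pF)); apply: leq_trans Yp.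
    by rewrite /Y0 -maxnA leq_maxl.
- by rewrite filter_uniq // iota_uniq.
- by apply/allP => p /FE[].
- move=> p /FE[pp _]; rewrite /Y0 !geq_max => /andP[/andP[_ p5] ps]; split => //.
  rewrite dvdzE /= => /dvdn_leq; rewrite absz_gt0 s0 => /(_ isT).
  by rewrite leqNgt ps.
- by move=> d dc; apply: Hcs; rewrite inE dc orbT.
Qed.

Lemma divisor_in_class_density (R : realType) (P : nat -> Prop) (M t : nat) (s : int) (eps : R) :
  shift_sievable R P -> s != 0 -> (0 < M)%N -> coprime t M -> 0 < eps ->
  density_le P (fun q => ~ exists f : nat, (f%:Z %| q%:Z + s)%Z /\ f = t %[mod M]) eps.
Proof.
move=> sP s0 M0 ct e0; have [cs Hcs e] := coprime_rich_product R M0 ct.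
have [x0 H] := rich_seq_density sP s0 Hcs 0 e0.
exists x0 => x /H; apply: le_trans; rewrite ler_nat; apply: count_upto_le => q [Pq nf].
split=> // -[f [fq ef _]]; apply: nf; exists f; split => //; by rewrite ef.
Qed.

(** * Membership in the groups H_q *)

Definition mx22 (a b c d : int) : 'M[int]_2 :=
  \matrix_(i, j) if i == 0 then (if j == 0 then a else b) else (if j == 0 then c else d).

Lemma mx22E (M : 'M[int]_2) : M = mx22 (M 0 0) (M 0 1) (M 1 0) (M 1 1).
Proof.
apply/matrixP => i j; rewrite mxE.
by case: i => [[|[|//]] hi]; case: j => [[|[|//]] hj]; congr (M _ _); apply: val_inj.
Qed.

Lemma mx22M (a b c d a' b' c' d' : int) :
  mx22 a b c d *m mx22 a' b' c' d' =
  mx22 (a * a' + b * c') (a * b' + b * d') (c * a' + d * c') (c * b' + d * d').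
Proof.
apply/matrixP => i j; rewrite !mxE big_ord_recl big_ord1 !mxE /=.
by case: i => [[|[|//]] hi]; case: j => [[|[|//]] hj].
Qed.

Lemma det_mx22 (a b c d : int) : \det (mx22 a b c d) = a * d - b * c.
Proof.
rewrite (expand_det_row _ 0) big_ord_recl big_ord1 /cofactor !det_mx11 !mxE /=.
by ring.
Qed.

Lemma mx22_1 : mx22 1 0 0 1 = 1%:M.
Proof.
apply/matrixP => i j; rewrite !mxE.
by case: i => [[|[|//]] hi]; case: j => [[|[|//]] hj].
Qed.

Lemma mx22_unit (a b c d : int) : a * d - b * c = 1 -> mx22 a b c d \in unitmx.
Proof. by move=> e; rewrite unitmxE det_mx22 e unitr1. Qed.

Lemma Gamma0_mx22 (N : nat) (a b c d : int) :
  a * d - b * c = 1 -> (N%:Z %| c)%Z -> Gamma0 N (mx22 a b c d).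
Proof. by move=> e Nc; split; rewrite /SL2Z /entC ?det_mx22 // !mxE. Qed.

Lemma Hq_base (N q : nat) (b c d : int) :
  q%:Z * d - b * c = 1 -> (N%:Z %| c)%Z -> Hq N q (mx22 q b c d).
Proof. by move=> e Nc; apply: gen_base; split; [exact: Gamma0_mx22|rewrite /entA mxE]. Qed.

Lemma Hq_cancel_l (N q : nat) (M G : 'M[int]_2) :
  M \in unitmx -> Hq N q M -> Hq N q (M *m G) -> Hq N q G.
Proof. by move=> uM HM HMG; rewrite -(mulKmx uM G); apply: gen_mul => //; apply: gen_inv. Qed.

Lemma Hq_cancel_r (N q : nat) (M G : 'M[int]_2) :
  M \in unitmx -> Hq N q M -> Hq N q (G *m M) -> Hq N q G.
Proof. by move=> uM HM HGM; rewrite -(mulmxK uM G); apply: gen_mul => //; apply: gen_inv. Qed.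

Lemma coprime_bezout (q N : nat) : coprime q N ->
  exists b d : int, q%:Z * d = 1 + N%:Z * b.
Proof.
move=> co; have /coprimezP[[u v] /= e] : coprimez q N by rewrite coprimezE.
exists (- v), u; lia.
Qed.

Lemma Hq_T (N q : nat) (x : int) : coprime q N -> Hq N q (mx22 1 x 0 1).
Proof.
move=> /coprime_bezout[b [d e]].
have HM : Hq N q (mx22 q b N d) by apply: Hq_base; rewrite ?e ?dvdzz //; ring.
apply: (Hq_cancel_l _ HM); first by apply: mx22_unit; rewrite e; ring.
rewrite mx22M.
have -> : q%:Z * 1 + b * 0 = q by ring.
have -> : N%:Z * 1 + d * 0 = N by ring.
apply: Hq_base; last exact: dvdzz.
by transitivity (q%:Z * d - N%:Z * b); [ring|rewrite e; ring].
Qed.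

Lemma Hq_U (N q : nat) (k : int) : coprime q N -> Hq N q (mx22 1 0 (N%:Z * k) 1).
Proof.
move=> /coprime_bezout[b [d e]].
have HM : Hq N q (mx22 q b N d) by apply: Hq_base; rewrite ?e ?dvdzz //; ring.
apply: (Hq_cancel_r _ HM); first by apply: mx22_unit; rewrite e; ring.
rewrite mx22M.
have -> : 1 * q%:Z + 0 * N%:Z = q by ring.
apply: Hq_base; last by rewrite -mulrA mul1r rpredD ?dvdzz // dvdz_mulr.
by transitivity (q%:Z * d - N%:Z * b); [ring|rewrite e; ring].
Qed.

(* With M1 = (q, B; N, D) and M2 = (q, *; N f, * ) one has M1 g = T ^ (- y) M2. *)
Lemma Hq_of_divisor (N q : nat) (a b c d D B f g y : int) :
  coprime q N -> a * d - b * (N%:Z * c) = 1 -> q%:Z * D = 1 + N%:Z * B ->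
  f = a + D * c -> f * g = q%:Z + c -> g = q%:Z + N%:Z * y ->
  Hq N q (mx22 a b (N%:Z * c) d).
Proof.
move=> co dt eD ef efg eg.
have HM : Hq N q (mx22 q B N D) by apply: Hq_base; rewrite ?eD ?dvdzz //; ring.
apply: (Hq_cancel_l _ HM); first by apply: mx22_unit; rewrite eD; ring.
have uT : mx22 1 y 0 1 \in unitmx by apply: mx22_unit; ring.
apply: (Hq_cancel_l uT (Hq_T y co)).
have dP : \det (mx22 1 y 0 1 *m (mx22 q B N D *m mx22 a b (N%:Z * c) d)) = 1.
  by rewrite !det_mulmx !det_mx22 dt eD; ring.
apply: gen_base; split; [split => //|]; rewrite !mx22M ?/entA ?/entC mxE /=.
  have -> : 0 * (q%:Z * a + B * (N%:Z * c)) + 1 * (N%:Z * a + D * (N%:Z * c)) = N%:Z * f.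
    by rewrite ef; ring.
  by rewrite dvdz_mulr ?dvdzz.
transitivity (q%:Z * a + (q%:Z * D - 1) * c + N%:Z * y * f).
  by rewrite eD ef; ring.
transitivity (f * g - c); last by rewrite efg; ring.
by rewrite eg ef; ring.
Qed.

Lemma Gamma1_shift (N : nat) (a c r : int) : (a = 1 %[mod N%:Z])%Z -> a != 0 \/ c != 0 ->
  (0 < N)%N -> exists k, c + k * a != 0 /\ (N%:Z %| r + (c + k * a) - 1)%Z.
Proof.
move=> /eqP; rewrite eqz_mod_dvd => Na ac0 N0.
have div l : (N%:Z %| r + (c + (1 - r - c + N%:Z * l) * a) - 1)%Z.
  have -> : r + (c + (1 - r - c + N%:Z * l) * a) - 1 =
    (1 - r - c) * (a - 1) + N%:Z * (l * a) by ring.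
  by apply: rpredD; [exact: dvdz_mull|exact: dvdz_mulr].
have [a0|a0] := eqVneq a 0.
  exists (1 - r - c + N%:Z * 0); split; last exact: div.
  by move: ac0; rewrite a0 mulr0 addr0 eqxx => -[].
have [e|] := eqVneq (c + (1 - r - c + N%:Z * 0) * a) 0; last by exists (1 - r - c + N%:Z * 0).
exists (1 - r - c + N%:Z * 1); split=> //.
have -> : c + (1 - r - c + N%:Z * 1) * a = N%:Z * a by rewrite -[RHS]add0r -e; ring.
by rewrite mulf_neq0 // -lt0n.
Qed.

Lemma Hq_of_class (N q : nat) (a b c d r D B : int) (f : nat) :
  (0 < N)%N -> coprime q N -> a * d - b * (N%:Z * c) = 1 -> (a = 1 %[mod N%:Z])%Z ->
  (N%:Z %| q%:Z - r)%Z -> r * D = 1 + N%:Z * B -> (N%:Z %| r + c - 1)%Z ->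
  (f%:Z %| q%:Z + c)%Z -> (f%:Z = a + D * c %[mod N%:Z * c])%Z ->
  Hq N q (mx22 a b (N%:Z * c) d).
Proof.
move=> N0 co dt /eqP; rewrite eqz_mod_dvd => /dvdzP[a1 ea] /dvdzP[m em] eD /dvdzP[w ew].
move=> /dvdzP[g eg] /eqP; rewrite eqz_mod_dvd => /dvdzP[l el].
have ef : f%:Z = a + (D + l * N%:Z) * c by rewrite -[LHS](subrK (a + D * c)) el; ring.
have eqD : q%:Z * (D + l * N%:Z) = 1 + N%:Z * (B + m * D + q%:Z * l).
  transitivity (r * D + (q%:Z - r) * D + q%:Z * (l * N%:Z)); first by ring.
  by rewrite em eD; ring.
set D' := D + l * N%:Z in ef eqD; set B' := B + _ + _ in eqD.
have Nrf : (N%:Z %| r * f%:Z - 1)%Z.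
  apply/dvdzP; exists (r * a1 + B * c + r * l * c + w).
  have ra : r * a - r = r * a1 * N%:Z by rewrite -mulrA -ea; ring.
  transitivity ((r * a - r) + (r * D - 1) * c + r * l * N%:Z * c + (r + c - 1)).
    by rewrite ef /D'; ring.
  by rewrite ra eD ew; ring.
have Nfgq : (N%:Z %| f%:Z * (g - q%:Z))%Z.
  apply/dvdzP; exists (- (q%:Z * a1) - B' * c).
  transitivity ((q%:Z + c) - q%:Z * a - (q%:Z * D') * c).
    transitivity (g * f%:Z - q%:Z * (a + D' * c)); first by rewrite -ef; ring.
    by rewrite -eg; ring.
  transitivity (- (q%:Z * (a - 1)) - (q%:Z * D' - 1) * c); first by ring.
  by rewrite ea eqD; ring.
have /dvdzP[y ey] : (N%:Z %| g - q%:Z)%Z.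
  have -> : g - q%:Z = r * (f%:Z * (g - q%:Z)) - (r * f%:Z - 1) * (g - q%:Z) by ring.
  by apply: rpredB; [exact: dvdz_mull|exact: dvdz_mulr].
apply: (@Hq_of_divisor N q a b c d _ _ f%:Z g y co dt eqD ef).
  by rewrite eg mulrC.
by rewrite mulrC -ey; ring.
Qed.

Lemma density_le_sub (R : realType) (P E E' : nat -> Prop) (eps : R) :
  (forall q, P q -> E q -> E' q) -> density_le P E' eps -> density_le P E eps.
Proof.
move=> EE [x0 H]; exists x0 => x /H; apply: le_trans; rewrite ler_nat.
by apply: count_upto_le => q [Pq /(EE q Pq)].
Qed.

Lemma density_le_void (R : realType) (P E : nat -> Prop) (eps : R) :
  0 <= eps -> (forall q, ~ E q) -> density_le P E eps.
Proof.
move=> e0 nE; exists 0%N => x _; rewrite /count_upto big_pred0 ?mulr_ge0 // => q.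
by apply: asboolF => -[_ /nE].
Qed.

Lemma density_le_seq (R : realType) (I : eqType) (r : seq I) (P : nat -> Prop)
    (E : I -> nat -> Prop) :
  (forall i, i \in r -> forall eps : R, 0 < eps -> density_le P (E i) eps) ->
  forall eps : R, 0 < eps -> density_le P (fun q => exists2 i, i \in r & E i q) eps.
Proof.
elim: r => [|i r IHr] H eps e0; first by apply: density_le_void; [exact: ltW|move=> q []].
have e2 : 0 < eps / 2 by rewrite divr_gt0.
rewrite [eps]splitr; apply: (density_le_or _ (H i (mem_head _ _) _ e2) (IHr _ _ e2)).
  move=> q _ [j]; rewrite inE => /orP[/eqP->|jr Ej]; first by left.
  by right; exists j.
by move=> j jr; apply: H; rewrite inE jr orbT.
Qed.

Lemma Gamma1_density (R : realType) (P : nat -> Prop) (N : nat) (G : 'M[int]_2) (eps : R) :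
  shift_sievable R P -> (0 < N)%N -> Gamma1 N G -> 0 < eps ->
  density_le P (fun q => coprime q N /\ ~ Hq N q G) eps.
Proof.
move=> sP N0 [[dG NC] [a1 _]] e0.
rewrite /SL2Z /entA /entC in dG NC a1.
move: (mx22E G) dG NC a1; move: (G 0 0) (G 0 1) (G 1 0) (G 1 1) => a b c' d -> {G}.
rewrite det_mx22 => dt /dvdzP[c ec] a1; rewrite {c'}ec (mulrC c) in dt *.
pose E r q := [/\ coprime q N, q %% N = r & ~ Hq N q (mx22 a b (N%:Z * c) d)]%N.
suff cls r : r \in iota 0 N -> forall e : R, 0 < e -> density_le P (E r) e.
  apply: density_le_sub (density_le_seq cls e0) => q _ [cq nH].
  by exists (q %% N)%N; [rewrite mem_iota /= add0n ltn_pmod|by split].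
move=> _ {eps e0}e e0.
have [cor|ncor] := boolP (coprime r N); last first.
  apply: density_le_void; first exact: ltW.
  by move=> q [cq qr _]; move: ncor; rewrite -qr coprime_modl cq.
have [B [D eD]] := coprime_bezout cor.
have ac0 : a != 0 \/ c != 0.
  have [a0|] := eqVneq a 0; last by left.
  by right; apply/eqP => c0; move: dt; rewrite a0 c0 !(mul0r, mulr0) subr0.
have [k [c00 Nk]] := Gamma1_shift r%:Z a1 ac0 N0.
set c0 := c + k * a in c00 Nk.
have shiftE : mx22 1 0 (N%:Z * k) 1 *m mx22 a b (N%:Z * c) d =
    mx22 a b (N%:Z * c0) (d + N%:Z * k * b).
  by rewrite mx22M; congr mx22; rewrite /c0; ring.
have dt0 : a * (d + N%:Z * k * b) - b * (N%:Z * c0) = 1 by rewrite -dt /c0; ring.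
pose M := (N * `|c0|)%N; have M0 : (0 < M)%N by rewrite muln_gt0 N0 absz_gt0.
have ME (x y : int) : (x = y %[mod M%:Z])%Z -> (x = y %[mod N%:Z * c0])%Z.
  move=> /eqP; rewrite eqz_mod_dvd => H; apply/eqP; rewrite eqz_mod_dvd.
  by apply: dvdz_trans H; rewrite dvdzE abszM.
pose t := `|((a + D * c0)%R %% M%:Z)%Z|%N.
have tE : t%:Z = ((a + D * c0) %% M%:Z)%Z by rewrite /t gez0_abs // modz_ge0 // -lt0n.
have cot : coprime t M.
  have -> : coprime t M = coprimez (a + D * c0) M%:Z by rewrite /coprimez -gcdz_modl -tE.
  have -> : coprimez (a + D * c0) M%:Z = coprimez (a + D * c0) (N%:Z * c0).
    by rewrite !coprimezE /M abszM.
  rewrite coprimezMr; apply/andP; split; apply/coprimezP.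
    have /eqP := a1; rewrite eqz_mod_dvd => /dvdzP[a2 ea].
    have /dvdzP[w ew] := Nk.
    exists (r%:Z, - (r%:Z * a2 + w + B * c0)) => /=.
    transitivity ((r%:Z * D - (1 + N%:Z * B)) * c0 + r%:Z * (a - 1 - a2 * N%:Z)
      + (r%:Z + c0 - 1 - w * N%:Z) + 1); first by ring.
    by rewrite eD ea ew; ring.
  exists (d + N%:Z * k * b, - (b * N%:Z + D * (d + N%:Z * k * b))) => /=.
  by rewrite -dt0; ring.
apply: density_le_sub (divisor_in_class_density sP c00 M0 cot e0) => q _ [cq qr nH].
move=> [f [fq ft]]; apply: nH.
apply: (@Hq_cancel_l N q (mx22 1 0 (N%:Z * k) 1)); [by apply: mx22_unit; ring|exact: Hq_U|].
rewrite shiftE; apply: (@Hq_of_class N q a b c0 _ r D B f N0 cq dt0 a1) => //.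
  by rewrite -eqz_mod_dvd -qr -modz_nat modz_mod.
by apply: ME; rewrite modz_nat ft -modz_nat tE modz_mod.
Qed.

(** * Finite generation of Gamma_1(N) *)

Definition matT : 'M[int]_2 := mx22 1 1 0 1.
Definition matTV : 'M[int]_2 := mx22 1 (-1) 0 1.
Definition matS : 'M[int]_2 := mx22 0 (-1) 1 0.

Lemma SL2Z_mx22 (M : 'M[int]_2) : SL2Z M -> M 0 0 * M 1 1 - M 0 1 * M 1 0 = 1.
Proof. by rewrite /SL2Z {1}(mx22E M) det_mx22. Qed.

Lemma SL2Z_right_ind (P : 'M[int]_2 -> Prop) :
  P 1%:M -> (forall M, P M -> [/\ P (M *m matT), P (M *m matTV) & P (M *m matS)]) ->
  forall M, SL2Z M -> P M.
Proof.
move=> P1 PS G dG.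
have PT k : forall M, P M -> P (M *m mx22 1 k 0 1).
  elim/int_ind: k => [|n IHn|n IHn] M HM; first by rewrite mx22_1 mulmx1.
    have [+ _ _] := PS _ (IHn _ HM); rewrite -mulmxA mx22M.
    by congr (P (_ *m mx22 _ _ _ _)); rewrite ?intS; ring.
  have [_ + _] := PS _ (IHn _ HM); rewrite -mulmxA mx22M.
  by congr (P (_ *m mx22 _ _ _ _)); rewrite ?intS; ring.
have PSM M : P M -> P (M *m matS) by move=> /PS[].
have PN M : P M -> P (M *m mx22 (-1) 0 0 (-1)).
  by move=> /PSM/PSM; rewrite -mulmxA mx22M; congr (P (_ *m mx22 _ _ _ _)); ring.
suff key n a b c d M : (`|c| < n)%N -> a * d - b * c = 1 -> P M -> P (M *m mx22 a b c d).
  rewrite -[G]mul1mx (mx22E G); apply: (key (`|G 1 0|.+1)) => //; exact: SL2Z_mx22.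
elim: n a b c d M => [//|n IHn] a b c d M cn dt HM.
have [c0|c0] := eqVneq c 0.
  have ad : a * d = 1 by rewrite -dt c0 mulr0 subr0.
  have [[-> ->]|[-> ->]] : (a = 1 /\ d = 1) \/ (a = -1 /\ d = -1).
    have /eqP : (`|a| * `|d| = 1)%N by rewrite -abszM ad.
    rewrite muln_eq1 => /andP[/eqP a1 _].
    have [ea|ea] : a = 1 \/ a = -1 by lia.
      by left; move: ad; rewrite ea; lia.
    by right; move: ad; rewrite ea; lia.
    by rewrite c0; apply: PT.
  have := PN _ (PT (- b) _ HM); rewrite -mulmxA mx22M c0.
  by congr (P (_ *m mx22 _ _ _ _)); ring.
pose k := (a %/ c)%Z; pose r := (a %% c)%Z.
have aE : a = k * c + r by exact: divz_eq.
have rc : (`|r| < n)%N.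
  have r0 : 0 <= r by rewrite modz_ge0.
  have : r < `|c| by rewrite ltz_mod.
  by move: r0 cn; clear; lia.
have dt' : c * (k * d - b) - d * - r = 1 by rewrite -dt aE; ring.
have := IHn c d (- r) (k * d - b) _ _ dt' (PSM _ (PT k _ HM)).
rewrite abszN => /(_ rc); rewrite -!mulmxA !mx22M.
by congr (P (_ *m mx22 _ _ _ _)); rewrite ?aE; ring.
Qed.

Definition mx_cong (N : nat) (M M' : 'M[int]_2) : Prop :=
  forall i j, (N%:Z %| M i j - M' i j)%Z.

Lemma mx_cong_mulr (N : nat) (M M' S : 'M[int]_2) :
  mx_cong N M M' -> mx_cong N (M *m S) (M' *m S).
Proof.
move=> H i j; rewrite !mxE -sumrB; apply: rpred_sum => k _.
by rewrite -mulrBl dvdz_mulr.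
Qed.

Lemma mx_cong_sym (N : nat) (M M' : 'M[int]_2) : mx_cong N M M' -> mx_cong N M' M.
Proof. by move=> H i j; rewrite -opprB rpredN. Qed.

Lemma mx_cong_trans (N : nat) (M1 M2 M3 : 'M[int]_2) :
  mx_cong N M1 M2 -> mx_cong N M2 M3 -> mx_cong N M1 M3.
Proof. by move=> H H' i j; rewrite -(subrK (M2 i j) (M1 i j)) -addrA rpredD. Qed.

Lemma Gamma1_cong1 (N : nat) (M : 'M[int]_2) : SL2Z M -> mx_cong N M 1%:M -> Gamma1 N M.
Proof.
move=> dM H; split; [split=> //|split; apply/eqP; rewrite eqz_mod_dvd].
- by have := H 1 0; rewrite !mxE subr0.
- by have := H 0 0; rewrite !mxE.
- by have := H 1 1; rewrite !mxE.
Qed.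

Lemma Gamma1_cong (N : nat) (M M' : 'M[int]_2) :
  SL2Z M' -> mx_cong N M M' -> Gamma1 N M -> Gamma1 N M'.
Proof.
move=> dM' H [[dM NC] [/eqP HA /eqP HD]]; rewrite eqz_mod_dvd in HA; rewrite eqz_mod_dvd in HD.
split; [split=> //|split; apply/eqP; rewrite eqz_mod_dvd].
- by rewrite /entC -(subKr (M 1 0) (M' 1 0)) rpredB.
- rewrite /entA -(subrK (M 0 0) (M' 0 0)) -addrA rpredD // -opprB rpredN; exact: H.
- rewrite /entD -(subrK (M 1 1) (M' 1 1)) -addrA rpredD // -opprB rpredN; exact: H.
Qed.

Lemma SL2Z_unit (M : 'M[int]_2) : SL2Z M -> M \in unitmx.
Proof. by rewrite unitmxE => ->; rewrite unitr1. Qed.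

Lemma SL2Z_mul (M M' : 'M[int]_2) : SL2Z M -> SL2Z M' -> SL2Z (M *m M').
Proof. by rewrite /SL2Z det_mulmx => -> ->; rewrite mulr1. Qed.

Lemma SL2Z_inv (M : 'M[int]_2) : SL2Z M -> SL2Z (invmx M).
Proof. by rewrite /SL2Z det_inv => ->; rewrite invr1. Qed.

Lemma mx_cong_divr (N : nat) (M M' : 'M[int]_2) :
  SL2Z M' -> mx_cong N M M' -> mx_cong N (M *m invmx M') 1%:M.
Proof. by move=> dM' /(@mx_cong_mulr _ _ _ (invmx M')); rewrite mulmxV ?SL2Z_unit. Qed.

(* Schreier's argument: representatives of the classes modulo N, together with
   the elements rep * s * rep'^-1, generate Gamma1 N. *)
Lemma Gamma1_fin_gen (N : nat) : (0 < N)%N -> exists2 gs : seq 'M[int]_2,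
  (forall g, g \in gs -> Gamma1 N g) &
  forall q, (forall g, g \in gs -> Hq N q g) -> contains_Gamma1 N q.
Proof.
case: N => [//|N] _; pose n := N.+1.
pose cl (M : 'M[int]_2) : {ffun 'I_2 * 'I_2 -> 'I_n} :=
  [ffun p => inord `|(M p.1 p.2 %% n%:Z)%Z|].
have clE M M' : cl M = cl M' -> mx_cong n M M'.
  move=> e i j; rewrite -eqz_mod_dvd; apply/eqP.
  have := congr1 (fun f : {ffun 'I_2 * 'I_2 -> 'I_n} => val (f (i, j))) e.
  have lt (x : int) : (`|(x %% n%:Z)%Z| < n)%N by rewrite -ltz_nat gez0_abs ?modz_ge0 // ltz_mod.
  rewrite !ffunE /= !inordK // => /(congr1 Posz).
  by rewrite !gez0_abs ?modz_ge0.
have /choice[rep Hrep] (k : {ffun 'I_2 * 'I_2 -> 'I_n}) : exists M, SL2Z M /\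
    forall M', SL2Z M' -> cl M' = k -> mx_cong n M M'.
  have [[M [dM ck]]|nM] := pselect (exists M, SL2Z M /\ cl M = k).
    by exists M; split => // M' _ ck'; apply: clE; rewrite ck ck'.
  exists 1%:M; split; first exact: det1.
  by move=> M' dM' ck'; case: nM; exists M'.
have drep k : SL2Z (rep k) by have [] := Hrep k.
have crep M : SL2Z M -> mx_cong n (rep (cl M)) M by have [_ H] := Hrep (cl M); move/H; apply.
pose gens := [:: matT; matTV; matS].
have dgen s : s \in gens -> SL2Z s.
  by rewrite !inE => /or3P[] /eqP ->; rewrite /SL2Z det_mx22; ring.
pose class := {ffun 'I_2 * 'I_2 -> 'I_n}.
pose all_g := [seq rep p.1 *m s *m invmx (rep p.2) | p <- enum {: class * class}, s <- gens]
  ++ [seq rep k | k <- enum {: class}].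
exists [seq g <- all_g | `[< Gamma1 n g >]].
  by move=> g; rewrite mem_filter => /andP[/asboolP].
move=> q HG.
have Hrep1 k : Gamma1 n (rep k) -> Hq n q (rep k).
  move=> G1; apply: HG; rewrite mem_filter; apply/andP; split; first exact/asboolP.
  by rewrite mem_cat; apply/orP; right; apply/mapP; exists k; rewrite ?mem_enum.
have Hgen k k' s : s \in gens -> Gamma1 n (rep k *m s *m invmx (rep k')) ->
    Hq n q (rep k *m s *m invmx (rep k')).
  move=> sg G1; apply: HG; rewrite mem_filter; apply/andP; split; first exact/asboolP.
  rewrite mem_cat; apply/orP; left.
  by apply/allpairsP; exists ((k, k'), s); rewrite mem_enum.
pose P M := SL2Z M /\ exists2 h, Hq n q h & M = h *m rep (cl M).
have step M s : s \in gens -> P M -> P (M *m s).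
  move=> sg [dM [h Hh ME]]; have dMs := SL2Z_mul dM (dgen s sg).
  split => //; pose g := rep (cl M) *m s *m invmx (rep (cl (M *m s))).
  exists (h *m g).
    apply: gen_mul => //; apply: Hgen => //; apply: Gamma1_cong1.
      by apply: SL2Z_mul; [apply: SL2Z_mul => //; exact: dgen|exact: SL2Z_inv].
    apply: mx_cong_divr => //; apply: mx_cong_trans (mx_cong_sym (crep _ dMs)).
    by apply: mx_cong_mulr; apply: crep.
  by rewrite /g mulmxA mulmxKV ?SL2Z_unit // mulmxA -ME.
have PG M : SL2Z M -> P M.
  apply: SL2Z_right_ind.
    have d1 : SL2Z 1%:M by exact: det1.
    split => //; exists (invmx (rep (cl 1%:M))); last by rewrite mulVmx ?SL2Z_unit.
    apply: gen_inv; apply: Hrep1; apply: Gamma1_cong1 => //; exact: crep.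
  by move=> M' PM'; split; apply: step; rewrite // !inE eqxx ?orbT.
move=> M G1; have [dM _] := G1.1; have [_ [h Hh ->]] := PG M dM.
apply: gen_mul => //; apply: Hrep1; apply: Gamma1_cong G1 => //.
by apply: mx_cong_sym; apply: crep.
Qed.

(** * Conclusion *)

Lemma contains_Gamma1_density (R : realType) (P : nat -> Prop) (N : nat) (eps : R) :
  shift_sievable R P -> (0 < N)%N -> 0 < eps ->
  density_le P (fun q => coprime q N /\ ~ contains_Gamma1 N q) eps.
Proof.
move=> sP N0 e0; have [gs gsG gsH] := Gamma1_fin_gen N0.
pose E (g : 'M[int]_2) q := coprime q N /\ ~ Hq N q g.
have H g : g \in gs -> forall e : R, 0 < e -> density_le P (E g) e.
  by move=> /gsG gG e; apply: Gamma1_density.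
apply: density_le_sub (density_le_seq H e0) => q _ [cq nC].
apply: contrapT => nE; apply: nC; apply: gsH => g gg.
by apply: contrapT => nH; apply: nE; exists g.
Qed.

Lemma count_coprime_approx (R : realFieldType) (N x : nat) : (0 < N)%N ->
  `|(count_upto (fun q => coprime q N) x)%:R - x%:R * ((totient N)%:R / N%:R)| <= 2 * N%:R + 1 :> R.
Proof.
move=> N0; pose u n : R := (coprime n N)%:R.
have uN n : u (n + N)%N = u n by rewrite /u -coprime_modl modnDr coprime_modl.
have u1 n : `|u n| <= 1 by rewrite /u; case: coprime; rewrite ?normr1 ?normr0.
have sE : \sum_(n < N) u n = N%:R * ((totient N)%:R / N%:R).
  rewrite mulrC divfK ?pnatr_eq0 -?lt0n // totient_count_coprime natr_sum big_mkord.
  by apply: eq_bigr => n _; rewrite coprime_sym.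
have cE : (count_upto (fun q => coprime q N) x)%:R = \sum_(n < x) u n.+1.
  rewrite /count_upto big_add1 big_mkord natr_sum big_mkcond /=.
  by apply: eq_bigr => n _; rewrite asboolb /u; case: coprime.
have uS : \sum_(n < N) u n.+1 = N%:R * ((totient N)%:R / N%:R).
  rewrite -sE; apply: (addrI (u 0%N)).
  rewrite -(big_ord_recl N (fun n : 'I_N.+1 => u n)) big_ord_recr /= addrC; congr (_ + _).
  by rewrite -[N]add0n uN.
rewrite cE; apply: le_trans (@sum_periodic_approx R (fun n => u n.+1) N x _ N0 _ _ uS) _.
- by move=> n; rewrite -addSn uN.
- by move=> n; apply: u1.
- by rewrite lerDl.
Qed.

Lemma primepi_unbounded (k : nat) : exists x0, forall x, (x0 <= x)%N -> (k <= primepi x)%N.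
Proof.
have mono x y : (x <= y)%N -> (primepi x <= primepi y)%N.
  by move=> xy; rewrite /primepi [leqRHS](big_cat_nat (n := x.+1)) //= leq_addr.
suff [x0 H] : exists x0, (k <= primepi x0)%N by exists x0 => x /mono; apply: leq_trans.
elim: k => [|k [x0 IH]]; first by exists 0%N.
have [p xp pp] := prime_above x0; exists p.
rewrite /primepi big_mkcond big_nat_recr //= pp -big_mkcond addn1 ltnS /= (leq_trans IH) //.
by rewrite /primepi [leqRHS](big_cat_nat (n := x0.+1)) //= leq_addr.
Qed.

Local Open Scope classical_set_scope.

Theorem theorem3p2 (R : realType) (N : nat) (hN : (0 < N)%N) :
  ((fun x : nat =>
      (count_upto (fun q => coprime q N /\ contains_Gamma1 N q) x)%:R / x%:R : R)
     @ \oo --> ((totient N)%:R / N%:R : R))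
  /\
  ((fun x : nat =>
      (count_upto (fun q => prime q /\ ~~ (q %| N)%N /\ contains_Gamma1 N q) x)%:R
        / (primepi x)%:R : R)
     @ \oo --> (1 : R)).
Proof.
split; apply/cvgrPdist_le => eps e0; have e2 : 0 < eps / 2 by rewrite divr_gt0.
  have [x0 Hx0] := contains_Gamma1_density (@shift_sievable_nat R) hN e2.
  pose C : R := 2 * N%:R + 1; have C0 : 0 <= C by rewrite /C addr_ge0 ?mulr_ge0.
  exists (maxn x0 (Num.bound (C / (eps / 2))).+1) => // x; rewrite /= geq_max => /andP[x0x Cx].
  have x_gt0 : 0 < x%:R :> R by rewrite ltr0n (leq_ltn_trans _ Cx).
  have Cx' : C <= x%:R * (eps / 2).
    rewrite -ler_pdivrMr //; apply: le_trans (ltW (archi_boundP _)) _; first by rewrite divr_ge0 // ltW.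
    by rewrite ler_nat ltnW.
  have bad := Hx0 x x0x; rewrite count_upto_true in bad.
  have split_c : (count_upto (fun q => coprime q N) x)%:R =
      (count_upto (fun q => coprime q N /\ contains_Gamma1 N q) x)%:R +
      (count_upto (fun q => True /\ (coprime q N /\ ~ contains_Gamma1 N q)) x)%:R :> R.
    rewrite -natrD (count_upto_split _ (contains_Gamma1 N)); congr (_ + _)%:R.
    by apply/eqP; rewrite eqn_leq !count_upto_le //; tauto.
  have := count_coprime_approx R x hN; rewrite -/C split_c.
  move: bad; set b := (count_upto _ x)%:R; set g := (count_upto _ x)%:R.
  move=> bad approx; have b0 : 0 <= b by rewrite /b.
  rewrite -[X in X - _](mulfK (lt0r_neq0 x_gt0)) -mulrBl normrM normfV (gtr0_norm x_gt0).
  rewrite ler_pdivrMr // ler_norml; move: approx; rewrite ler_norml => /andP[h1 h2].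
  by apply/andP; split; lra.
have [x0 Hx0] := contains_Gamma1_density (@shift_sievable_prime R) hN e2.
pose C : R := N.+1%:R; have C0 : 0 <= C by [].
have [x1 Hx1] := primepi_unbounded (Num.bound (C / (eps / 2))).+1.
exists (maxn x0 x1) => // x; rewrite /= geq_max => /andP[x0x /Hx1 Cx].
have p_gt0 : 0 < (primepi x)%:R :> R by rewrite ltr0n (leq_ltn_trans _ Cx).
have Cx' : C <= (primepi x)%:R * (eps / 2).
  rewrite -ler_pdivrMr //; apply: le_trans (ltW (archi_boundP _)) _; first by rewrite divr_ge0 // ltW.
  by rewrite ler_nat ltnW.
have bad := Hx0 x x0x; rewrite count_upto_prime in bad.
pose G q := ~~ (q %| N)%N /\ contains_Gamma1 N q.
have split_p : (primepi x)%:R = (count_upto (fun q => prime q /\ G q) x)%:R +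
    (count_upto (fun q => prime q /\ ~ G q) x)%:R :> R.
  by rewrite -natrD -count_upto_split count_upto_prime.
have rest : (count_upto (fun q => prime q /\ ~ G q) x)%:R <= C +
    (count_upto (fun q => prime q /\ (coprime q N /\ ~ contains_Gamma1 N q)) x)%:R :> R.
  rewrite -natrD ler_nat; apply: leq_trans (leq_add (count_upto_lt N.+1 x) (leqnn _)).
  apply: leq_trans (count_upto_or _ _ _); apply: count_upto_le => q [pq nG].
  have [qN|qN] := boolP (q %| N)%N; first by left; rewrite ltnS dvdn_leq.
  by right; split => //; rewrite prime_coprime //; split => // HC; apply: nG.
move: bad split_p rest; rewrite -/(G _).
set b := (count_upto (fun q => prime q /\ (coprime _ _ /\ _)) x)%:R.
set r := (count_upto (fun q => prime q /\ ~ G q) x)%:R.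
set g := (count_upto (fun q => prime q /\ G q) x)%:R => bad split_p rest.
have r0 : 0 <= r by rewrite /r.
rewrite -[X in X - _](divff (lt0r_neq0 p_gt0)) -mulrBl normrM normfV (gtr0_norm p_gt0).
rewrite ler_pdivrMr // [X in X - g]split_p addrC addKr ger0_norm //; lra.
Qed.
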